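(* Let $\mathsf F$ be a nonempty closed subset of $\mathsf H$ and let $(\lambda_n)_{n\in\mathbb N}$ be a sequence in $]0,1]$. In addition, let $(x_n)_{n\in\mathbb N}$, $(t_n)_{n\in\mathbb N}$, $(c_n)_{n\in\mathbb N}$, and $(d_n)_{n\in\mathbb N}$ be sequences in $L^2(\Omega,\mathcal F,\mathsf P;\mathsf H)$. Suppose that the following are satisfied: (a) $\mathscr X=(\mathcal X_n)_{n\in\mathbb N}$ is a sequence of sub-sigma-algebras of $\mathcal F$ such that, for every $n\in\mathbb N$, $\sigma(x_0,\ldots,x_n)\subset\mathcal X_n\subset\mathcal X_{n+1}$. (b) For every $n\in\mathbb N$, $x_{n+1}=x_n+\lambda_n(t_n+c_n-x_n)$. (c) $\sum_{n\in\mathbb N}\lambda_n\sqrt{\mathsf E(\|c_n\|^2\mid\mathcal X_n)}<+\infty$ and $\sum_{n\in\mathbb N}\sqrt{\lambda_n\mathsf E(\|d_n\|^2\mid\mathcal X_n)}<+\infty$. (d) For every $\mathsf z\in\mathsf F$, there exist a sequence $(s_n(\mathsf z))_{n\in\mathbb N}$ of $\mathsf H$-valued random variables, $(\theta_{1,n}(\mathsf z))_{n\in\mathbb N}\in\ell_+(\mathscr X)$, $(\theta_{2,n}(\mathsf z))_{n\in\mathbb N}\in\ell_+(\mathscr X)$, $(\mu_{1,n}(\mathsf z))_{n\in\mathbb N}\in\ell_+^\infty(\mathscr X)$, $(\mu_{2,n}(\mathsf z))_{n\in\mathbb N}\in\ell_+^\infty(\mathscr X)$, $(\nu_{1,n}(\mathsf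 z))_{n\in\mathbb N}\in\ell_+^\infty(\mathscr X)$, and $(\nu_{2,n}(\mathsf z))_{n\in\mathbb N}\in\ell_+^\infty(\mathscr X)$ such that $(\lambda_n\mu_{1,n}(\mathsf z))_{n\in\mathbb N}\in\ell_+^1(\mathscr X)$, $(\lambda_n\mu_{2,n}(\mathsf z))_{n\in\mathbb N}\in\ell_+^1(\mathscr X)$, $(\lambda_n\nu_{1,n}(\mathsf z))_{n\in\mathbb N}\in\ell_+^{1/2}(\mathscr X)$, $(\lambda_n\nu_{2,n}(\mathsf z))_{n\in\mathbb N}\in\ell_+^{1/2}(\mathscr X)$, and, for every $n\in\mathbb N$, $$\mathsf E(\|t_n-\mathsf z\|^2\mid\mathcal X_n)+\theta_{1,n}(\mathsf z)\le(1+\mu_{1,n}(\mathsf z))\,\mathsf E(\|s_n(\mathsf z)+d_n\|^2\mid\mathcal X_n)+\nu_{1,n}(\mathsf z)$$ and $$\mathsf E(\|s_n(\mathsf z)\|^2\mid\mathcal X_n)+\theta_{2,n}(\mathsf z)\le(1+\mu_{2,n}(\mathsf z))\|x_n-\mathsf z\|^2+\nu_{2,n}(\mathsf z).$$ Then the following hold: (i) For every $\mathsf z\in\mathsf F$, $\sum_{n\in\mathbb N}\lambda_n\theta_{1,n}(\mathsf z)<+\infty$ and $\sum_{n\in\mathbb N}\lambda_n\theta_{2,n}(\mathsf z)<+\infty$ $\mathsf P$-a.s. (ii) $\sum_{n\in\mathbb N}\lambda_n(1-\lambda_n)\mathsf E(\|t_n-x_n\|^2\mid\mathcal X_n)<+\infty$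 $\mathsf P$-a.s. (iii) Suppose that $\mathfrak W(x_n)_{n\in\mathbb N}\subset\mathsf F$ $\mathsf P$-a.s. Then $(x_n)_{n\in\mathbb N}$ converges weakly $\mathsf P$-a.s. to an $\mathsf F$-valued random variable. (iv) Suppose that $\mathfrak S(x_n)_{n\in\mathbb N}\cap\mathsf F\ne\varnothing$ $\mathsf P$-a.s. Then $(x_n)_{n\in\mathbb N}$ converges strongly $\mathsf P$-a.s. to an $\mathsf F$-valued random variable. (v) Suppose that $\mathfrak S(x_n)_{n\in\mathbb N}\ne\varnothing$ $\mathsf P$-a.s. and that $\mathfrak W(x_n)_{n\in\mathbb N}\subset\mathsf F$ $\mathsf P$-a.s. Then $(x_n)_{n\in\mathbb N}$ converges strongly $\mathsf P$-a.s. to an $\mathsf F$-valued random variable.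
   Context: $\mathsf H$ is a separable real Hilbert space with scalar product $\langle\cdot\mid\cdot\rangle$, norm $\|\cdot\|$, and Borel $\sigma$-algebra $\mathcal B$. $(\Omega,\mathcal F,\mathsf P)$ is the underlying probability space. An $\mathsf H$-valued random variable is a measurable map $x\colon(\Omega,\mathcal F)\to(\mathsf H,\mathcal B)$; $L^2(\Omega,\mathcal F,\mathsf P;\mathsf H)$ is the space of (equivalence classes of) $\mathsf H$-valued random variables $x$ with $\int_\Omega\|x\|^2d\mathsf P<+\infty$. $\sigma(\Phi)$ is the smallest $\sigma$-algebra generated by a family $\Phi$ of random variables, and $\mathsf E(\cdot\mid\mathcal E)$ denotes conditional expectation with respect to a sub-sigma-algebra $\mathcal E$ of $\mathcal F$. Equalities and inequalities involving random variables are always understood to hold $\mathsf P$-almost surely, even when not expressly mentioned. For a sequence $\mathscr X=(\mathcal X_n)_{n\in\mathbb N}$ of sub-sigma-algebras as in (a), $\ell_+(\mathscr X)$ is the set of sequences $(\xi_n)_{n\in\mathbb N}$ of $[0,+\infty[$-valued random variables such that, for every $n$, $\xi_n$ is $\mathcal X_n$-measurable. For $p\in\,]0,+\infty[$, $\ell_+^p(\mathscr X)=\{(\xi_n)_{n\in\mathbb N}\in\ell_+(\mathscr X): \sum_{n\in\mathbb N}\xi_n^p<+\infty\ \mathsf P\text{-a.s.}\}$, and $\ell_+^\infty(\mathscr X)=\{(\xi_n)_{n\in\mathbb N}\in\ell_+(\mathscr X):\sup_{n\in\mathbb N}\xi_n<+\infty\ \mathsf P\text{-a.s.}\}$. $\mathfrak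 W(x_n)_{n\in\mathbb N}$ and $\mathfrak S(x_n)_{n\in\mathbb N}$ denote the sets of weak and of strong sequential cluster points, respectively, of a sequence in $\mathsf H$ (for random variables, these are taken pointwise in $\omega$). *)

(* Defs.v *)
From HB Require Import structures.
From mathcomp Require Export all_boot all_order all_algebra.
From mathcomp Require Export all_classical all_reals all_analysis measurable_realfun.

Set Implicit Arguments.
Unset Strict Implicit.
Unset Printing Implicit Defensive.

Export Order.TTheory GRing.Theory Num.Theory.
Export numFieldNormedType.Exports.

Local Open Scope classical_set_scope.
Local Open Scope ring_scope.

Definition separable (T : topologicalType) : Prop :=
  exists2 S : set T, countable S & dense S.

(* [{dot H for idfun}] is a symmetric positive definite bilinear form. *)
Definition induces_norm (R : realType) (H : normedModType R)
    (ip : {dot H for idfun}) : Prop :=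
  forall u : H, `|u| = Num.sqrt (ip u u).

Notation borelType H := (g_sigma_algebraType (@open H)).

Section random_variables.
Context d (T : measurableType d) (R : realType) (H : normedModType R).
Variable P : probability T R.

Definition random_vector (x : T -> H) : Prop :=
  measurable_fun [set: T] (x : T -> borelType H).

(* The a.s.-equivalence classes are represented by measurable functions. *)
Definition in_L2 (x : T -> H) : Prop :=
  random_vector x /\ (\int[P]_w (`|x w| ^+ 2)%:E < +oo)%E.

Definition is_sub_sigma_algebra (E : set (set T)) : Prop :=
  sigma_algebra [set: T] E /\ E `<=` measurable.

(* Since [E] is a sigma-algebra, [g_sigma_algebraType E] is [T] equipped
   with [E] itself. *)
Definition measurable_wrt (E : set (set T)) d' (U : measurableType d')
    (f : T -> U) : Prop :=
  measurable_fun [set: g_sigma_algebraType E] (f : g_sigma_algebraType E -> U).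

(* Versions of the conditional expectation of a nonnegative, possibly not
   integrable, random variable. *)
Definition is_cond_exp (E : set (set T)) (f g : T -> \bar R) : Prop :=
  [/\ measurable_wrt E g, (forall w, (0 <= g w)%E) &
      forall A, E A -> (\int[P]_(w in A) g w = \int[P]_(w in A) f w)%E].

(* A version exists for every measurable [f >= 0] (Radon-Nikodym and monotone
   convergence) and any two agree almost surely, so that the default value of
   [xget] is immaterial. *)
Definition cond_exp (E : set (set T)) (f : T -> \bar R) : T -> \bar R :=
  xget (cst 0%E) [set g | is_cond_exp E f g].

Definition ell_plus (X : nat -> set (set T)) (xi : nat -> T -> R) : Prop :=
  forall n, measurable_wrt (X n) (xi n) /\ forall w, 0 <= xi n w.

Definition ell_plus_p (p : R) (X : nat -> set (set T))
    (xi : nat -> T -> R) : Prop :=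
  ell_plus X xi /\
  {ae P, forall w, (\sum_(0 <= n <oo) (xi n w `^ p)%:E < +oo)%E}.

Definition ell_plus_oo (X : nat -> set (set T)) (xi : nat -> T -> R) : Prop :=
  ell_plus X xi /\
  {ae P, forall w, (ereal_sup (range (fun n => (xi n w)%:E)) < +oo)%E}.

End random_variables.

Section cluster_points.
Context (R : realType) (H : normedModType R) (ip : {dot H for idfun}).

Definition weakly_cvg_to (x : nat -> H) (l : H) : Prop :=
  forall u : H, ip (x n) u @[n --> \oo] --> ip l u.

Definition weak_cluster (x : nat -> H) : set H :=
  [set y | exists2 k : nat -> nat, increasing_seq k & weakly_cvg_to (x \o k) y].

Definition strong_cluster (x : nat -> H) : set H :=
  [set y | exists2 k : nat -> nat, increasing_seq k & x \o k @ \oo --> y].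

End cluster_points.

Section almost_sure_convergence.
Context d (T : measurableType d) (R : realType) (H : normedModType R).
Variables (P : probability T R) (ip : {dot H for idfun}).

Definition as_weakly_cvg_in (F : set H) (x : nat -> T -> H) : Prop :=
  exists y : T -> H, [/\ random_vector y, (forall w, F (y w)) &
    {ae P, forall w, weakly_cvg_to ip (x ^~ w) (y w)}].

Definition as_strongly_cvg_in (F : set H) (x : nat -> T -> H) : Prop :=
  exists y : T -> H, [/\ random_vector y, (forall w, F (y w)) &
    {ae P, forall w, x ^~ w @ \oo --> y w}].

End almost_sure_convergence.

(* Main.v *)
Require Import Defs.
From mathcomp Require Import ring lra.

(* For [z] in [F], Young's inequality
   [|u + v|^2 <= (1 + e) |u|^2 + (1 + 1/e) |v|^2], applied conditionally with the
   random parameters [e = lambda_n sqrt(E |c_n|^2) + 2^-n] and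
   [e = sqrt(lambda_n E |d_n|^2) + 2^-n], turns the recursion and the two
   inequalities of (d) into
   [E |x_{n+1} - z|^2 + theta_n <= (1 + chi_n) |x_n - z|^2 + eps_n], where [chi]
   and [eps] are almost surely summable and [theta_n] collects the terms of (i)
   and (ii).  By the Robbins-Siegmund theorem, [theta] is summable and
   [|x_n - z|] converges almost surely.  As [z |-> |x_n - z|] is 1-Lipschitz, a
   countable dense subset of [F] provides a null set outside of which [|x_n - z|]
   converges for all [z] in [F] simultaneously, and Opial's argument applies
   pathwise: two weak cluster points in [F] coincide.

   Convergence of a nonnegative supermartingale is a betting argument.  Buying
   below [a] and selling above [b], starting from the capital [a], one never goes
   bankrupt and earns [b - a] at each sale, while the expected wealth does not
   increase; hence there are almost surely finitely many sales. *)

Set Implicit Arguments.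
Unset Strict Implicit.
Unset Printing Implicit Defensive.

Local Open Scope classical_set_scope.
Local Open Scope ring_scope.

(** * Inner products, weak compactness and Opial's lemma *)

(** The obstacle is that conditional expectations are taken of nonnegative functions and may be
    infinite, so no cross term [<u, v>] may be integrated and no inequality may be subtracted.
    Young's inequality replaces the cross terms, negative terms are moved to the other side, and
    real arithmetic starts only once finiteness is known. The parameters balance the two terms of
    Young's inequality: for [e >= lambda_n sqrt(E |c_n|^2)] the price [e^-1 lambda_n^2 E |c_n|^2] is
    at most [lambda_n sqrt(E |c_n|^2)], the summable quantity of (c). The same works for [d_n],
    where the factor [lambda_n] comes from convexity of the squared norm along the relaxed step. The
    summand [2^-n] keeps [e] positive where the moment vanishes, at a summable cost. Convexity also
    leaves the term [lambda_n (1 - lambda_n) |t_n - x_n|^2], the source of (ii). *)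

Section inner_product.
Context (R : realType) (H : normedModType R) (ip : {dot H for idfun}).
Hypothesis ip_norm : induces_norm ip.
Implicit Types (u v w : H) (a : R).

Lemma ipC u v : ip u v = ip v u.
Proof. by rewrite hermC expr0 mul1r. Qed.

Lemma ipDl u v w : ip (u + v) w = ip u w + ip v w.
Proof. exact: linearDl. Qed.

Lemma ipDr u v w : ip w (u + v) = ip w u + ip w v.
Proof. exact: linearDr. Qed.

Lemma ipBl u v w : ip (u - v) w = ip u w - ip v w.
Proof. exact: linearBl. Qed.

Lemma ipBr u v w : ip w (u - v) = ip w u - ip w v.
Proof. exact: linearBr. Qed.

Lemma ipZl a u w : ip (a *: u) w = a * ip u w.
Proof. exact: linearZl_LR. Qed.

Lemma ipZr a u w : ip w (a *: u) = a * ip w u.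
Proof. exact: linearZr_LR. Qed.


Lemma ip0l u : ip 0 u = 0.
Proof. by rewrite -(subrr u) ipBl subrr. Qed.

Lemma sqr_norm_ip u : `|u| ^+ 2 = ip u u.
Proof.
rewrite ip_norm sqr_sqrtr //; have [->|u0] := eqVneq u 0; first by rewrite ip0l.
exact/ltW/neq0_dnorm_gt0.
Qed.

Lemma sqr_normD u v : `|u + v| ^+ 2 = `|u| ^+ 2 + 2 * ip u v + `|v| ^+ 2.
Proof. by rewrite !sqr_norm_ip !(ipDl, ipDr) (ipC v u); ring. Qed.

Lemma sqr_normB u v : `|u - v| ^+ 2 = `|u| ^+ 2 - 2 * ip u v + `|v| ^+ 2.
Proof. by rewrite !sqr_norm_ip !(ipBl, ipBr) (ipC v u); ring. Qed.

(** The squared norm of [|v|^2 u - <u, v> v] equals [|v|^2] times the defect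
    [|u|^2 |v|^2 - <u, v>^2], which is therefore nonnegative. *)
Lemma normr_ip_le u v : `|ip u v| <= `|u| * `|v|.
Proof.
rewrite -(@ler_pXn2r _ 2) ?nnegrE ?mulr_ge0 // exprMn real_normK ?num_real //.
have [->|v0] := eqVneq v 0; first by rewrite ipC ip0l normr0 expr0n/= mulr0.
have N0 : 0 < `|v| ^+ 2 by rewrite exprn_gt0 // normr_gt0.
have : 0 <= `|(`|v| ^+ 2) *: u - ip u v *: v| ^+ 2 by rewrite exprn_ge0.
rewrite sqr_normB !normrZ ipZl ipZr !exprMn !real_normK ?num_real //.
set N := `|v| ^+ 2 in N0 *; set p := ip u v.
have -> : N ^+ 2 * `|u| ^+ 2 - 2 * (N * (p * p)) + p ^+ 2 * N =
   N * (`|u| ^+ 2 * N - p ^+ 2) by ring.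
by rewrite pmulr_rge0 // subr_ge0.
Qed.

Lemma continuous_ip u : continuous (ip u).
Proof.
move=> v; apply/cvgrPdist_lt => e e0.
have d0 : 0 < e / (`|u| + 1) by rewrite divr_gt0 // ltr_wpDl.
near=> w.
rewrite -ipBr (le_lt_trans (normr_ip_le _ _))//.
have : ball v (e / (`|u| + 1)) w by near: w; exact: nbhsx_ballx.
rewrite -ball_normE /ball_ /=.
rewrite ltr_pdivlMr ?ltr_wpDl // mulrC; apply: le_lt_trans.
by rewrite ler_wpM2r // lerDl.
Unshelve. all: by end_near. Qed.

Lemma continuous_ipl v : continuous (ip ^~ v).
Proof.
have -> : ip ^~ v = ip v by apply/funext => u; rewrite ipC.
exact: continuous_ip.
Qed.

End inner_product.

(* The representing vector is the minimiser of [|u|^2 - 2 phi u]; minimising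
   sequences are Cauchy by the parallelogram identity. *)
Lemma riesz (R : realType) (H : completeNormedModType R) (ip :
  {dot H for idfun})
    (ip_norm : induces_norm ip) (phi : H -> R) (M : R) :
  (forall u v, phi (u + v) = phi u + phi v) ->
  (forall a u, phi (a *: u) = a * phi u) ->
  (forall u, `|phi u| <= M * `|u|) ->
  exists y, forall u, phi u = ip y u.
Proof.
move=> phiD phiZ phiM.
have phiB u v : phi (u - v) = phi u - phi v.
  by rewrite phiD -scaleN1r phiZ mulN1r.
pose J u := `|u| ^+ 2 - 2 * phi u.
have Jlb : has_inf (range J).
  split; first by exists (J 0), 0.
  exists (- M ^+ 2) => _ [u _ <-]; rewrite /J.
  have := phiM u; rewrite ler_norml => /andP[_ h].
  have : 0 <= (`|u| - M) ^+ 2 by rewrite sqr_ge0.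
  by nra.
pose m := inf (range J).
have mJ u : m <= J u by apply: ge_inf; [case: Jlb | exists u].
(* Comparison with the midpoint, where [J >= m]; the linear part of [J] cancels. *)
have par u v : `|u - v| ^+ 2 <= 2 * (J u - m) + 2 * (J v - m).
  have := mJ (2^-1 *: (u + v)).
  rewrite /J phiZ phiD normrZ exprMn.
  rewrite (sqr_normD ip_norm) (sqr_normB ip_norm) ger0_norm ?invr_ge0 //.
  rewrite -[2^-1 ^+ 2]/(2^-1 * 2^-1).
  by lra.
have /choice[u uJ] : forall n : nat, exists u, J u < m + n.+1%:R^-1.
  move=> n; have [|_ [u _ <-] ?] := @inf_adherent _ (range J) n.+1%:R^-1 _ Jlb.
    by rewrite invr_gt0.
  by exists u.
have ucvg : cvg (u @ \oo).
  apply: cauchy_cvg; apply/cauchy_ballP => e e0.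
  (* Chosen so that the bound [2 d + 2 d] given by [par] is [e^2]. *)
  pose d : R := e ^+ 2 / 4.
  have d0 : 0 < d by rewrite divr_gt0 // exprn_gt0.
  have small : \forall n \near \oo, (n.+1%:R^-1 : R) < d.
    exact: near_infty_natSinv_lt (PosNum d0).
  exists ([set u n | n in [set n | (n.+1%:R^-1 : R) < d]],
          [set u n | n in [set n | (n.+1%:R^-1 : R) < d]]).
    by split; apply: filterS small => n nd; exists n.
  move=> [_ _] [/= [n nd <-] [k kd <-]].
  rewrite -ball_normE /ball_ /= -(@ltr_pXn2r _ 2) ?nnegrE ?(ltW e0)//.
  apply: le_lt_trans (par _ _) _.
  have := uJ n; have := uJ k.
  have -> : e ^+ 2 = 4 * d by rewrite /d mulrC divfK.
  move: n.+1%:R^-1 k.+1%:R^-1 nd kd => a b.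
  by lra.
pose y := lim (u @ \oo).
have Jy : J y <= m.
  apply/ler_addgt0Pr => e e0.
  have Jc : J \o u @ \oo --> J y.
    apply: cvgB.
      by apply: cvgM; apply: cvg_norm; exact: ucvg.
    apply: cvgMl_tmp.
    apply/cvgrPdist_lt => d d0.
    have M0 : 0 < `|M| + 1 by rewrite ltr_wpDl.
    have /cvgrPdist_lt/(_ (d / (`|M| + 1)))[|N _ uN] := ucvg.
      by rewrite divr_gt0.
    exists N => // n /uN /=; rewrite ltr_pdivlMr // => h.
    rewrite -phiB; apply: le_lt_trans (phiM _) _; apply: le_lt_trans h.
    rewrite mulrC ler_wpM2l //; have := ler_norm M; lra.
  apply: (cvgr_to_le Jc); near=> n.
  rewrite /=; apply: le_trans (ltW (uJ n)) _; rewrite lerD2l.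
  near: n.
  by apply: filterS (near_infty_natSinv_lt (PosNum e0)) => n /ltW.
exists y => v; apply/eqP; rewrite -subr_eq0 -sqrf_eq0 eq_le sqr_ge0 andbT.
set r := phi v - ip y v.
have N0 : 0 < `|v| ^+ 2 + 1 by rewrite ltr_wpDl ?exprn_ge0.
(* First-order optimality of [y] in the direction [v]: the step [s * r] changes [J] by
   [s r^2 (s |v|^2 - 2)], which is negative unless [r = 0] because [s |v|^2 < 1]. The summand 1 in
   [s] covers [v = 0]. *)
pose s := (`|v| ^+ 2 + 1)^-1.
have := le_trans Jy (mJ (y + (s * r) *: v)).
rewrite /J (sqr_normD ip_norm) phiD phiZ (ipZr ip) normrZ exprMn.
rewrite real_normK ?num_real // => h.
have {h} : 0 <= s * r ^+ 2 * (s * `|v| ^+ 2 - 2) by rewrite /r in h *; nra.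
have s0 : 0 < s by rewrite invr_gt0.
have : s * `|v| ^+ 2 - 2 < -1.
  have : s * (`|v| ^+ 2 + 1) = 1 by rewrite mulVf // gt_eqF.
  by lra.
move=> h1 h2; rewrite leNgt; apply/negP => r0.
suff : s * r ^+ 2 * (s * `|v| ^+ 2 - 2) < 0 by lra.
by rewrite (pmulr_rlt0 _ (mulr_gt0 s0 r0)); exact: lt_trans h1 (ltrN10 _).
Unshelve. all: by end_near. Qed.

(** * Dense sequences, extraction of subsequences and weak compactness *)

Lemma dense_seq (R : realType) (H : normedModType R) : separable H ->
  exists e : nat -> H, forall (u : H) (r :
    R), 0 < r -> exists i, `|u - e i| < r.
Proof.
move=> [S S_countable S_dense].
have near_S u (r : R) : 0 < r -> exists2 z, S z & `|u - z| < r.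
  move=> r0; have [|//|z [uz Sz]] := S_dense (ball u r).
  - by exists u; exact: ballxx.
  - exact: ball_open.
  by exists z => //; rewrite -ball_normE in uz.
have [z0 Sz0 _] := near_S 0 1 ltr01.
have /countable_injP[f f_inj] := S_countable.
exists (fun i => xget z0 [set z | S z /\ f z = i]) => u r r0.
have [z Sz uz] := near_S u r r0; exists (f z).
case: xgetP => [z' _ [Sz' fz]|/(_ z)[]]//.
by rewrite (f_inj z' z) ?inE.
Qed.

(** The dense points of [H] need not lie in [F]. In each ball of radius [1/(j+1)] around some [e i]
    a point of [F] is selected, with default [z0] where the ball misses [F]. A point of [F] in such
    a ball is within [r] of the selected one as soon as [1/(j+1) < r/2]. *)
Lemma dense_seq_in (R : realType) (H : normedModType R) (F : set H) :
  separable H -> F !=set0 ->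
  exists2 e : nat -> H, forall i, F (e i) &
    forall u (r : R), F u -> 0 < r -> exists i, `|u - e i| < r.
Proof.
move=> /dense_seq[e e_dense] [z0 Fz0].
pose near_e (p : nat * nat) := [set z | F z /\ `|z - e p.1| < p.2.+1%:R^-1].
pose g n := xget z0 (near_e (odflt (0, 0)%N (unpickle n))).
exists g => [i|u r Fu r0].
  by rewrite /g; case: xgetP => [z _ []|].
have r20 : 0 < r / 2 by rewrite divr_gt0.
have [j _ /(_ j (leqnn j)) /= jr] := near_infty_natSinv_lt (PosNum r20).
have [i ui] : exists i, `|u - e i| < j.+1%:R^-1.
  by apply: e_dense; rewrite invr_gt0.
exists (pickle (i, j)); rewrite /g pickleK /=.
case: xgetP => [z _ [Fz /= zi]|/(_ u)[]]//.
have -> : u - z = (u - e i) - (z - e i) by rewrite opprB addrA subrK.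
apply: le_lt_trans (ler_normB _ _) _; rewrite (splitr r).
by apply: ltrD; [exact: lt_trans jr | exact: lt_trans jr].
Qed.

Lemma increasing_seq_ge (k : nat -> nat) : increasing_seq k ->
  forall n, (n <= k n)%N.
Proof.
move=> /increasing_seqP k_incr; elim=> // n IHn.
by apply: leq_ltn_trans IHn _; exact: k_incr.
Qed.

(** The search at stage [j + 1] starts just after the index found at stage [j]. With [Q] depending
    on [j] this is a diagonal extraction; with [Q] constant in [j] it enumerates an infinite set of
    indices. *)
Lemma extract_subseq (Q : nat -> nat -> Prop) :
  (forall j N, exists2 n, (N <= n)%N & Q j n) ->
  exists2 k : nat -> nat, increasing_seq k & forall j, Q j (k j).
Proof.
move=> Qinf.
have /choice[g gP] : forall p : nat * nat,
    exists n, (p.2 <= n)%N /\ Q p.1 n.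
  by move=> [j N]; have [n ? ?] := Qinf j N; exists n.
pose k := fix k j := if j is j'.+1 then g (j, (k j').+1) else g (0, 0)%N.
exists k; last by case=> [|j] /=; [have [] := gP (0, 0)%N | have [] := gP
  (j.+1, (k j).+1)].
apply/increasing_seqP => n /=.
by have [] := gP (n.+1, (k n).+1).
Qed.

(* The weak limit is taken along an ultrafilter first, and a subsequence
   converging to it is extracted afterwards. *)
Lemma bounded_weak_cluster (R : realType) (H : completeNormedModType R)
    (ip : {dot H for idfun}) (ip_norm : induces_norm ip) (x : nat -> H) (M :
      R) :
  separable H -> (forall n, `|x n| <= M) -> weak_cluster ip x !=set0.
Proof.
move=> /dense_seq[e e_dense] xM.
have M0 : 0 <= M by exact: le_trans (xM 0%N).
have ip_le u n : `|ip (x n) u| <= M * `|u|.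
  by apply: le_trans (normr_ip_le ip_norm _ _) _; rewrite ler_wpM2r.
have [U [U_ultra U_oo]] := ultraFilterLemma (@eventually_filter).
have U_proper := @ultra_proper _ _ U_ultra.
(* Limits along [U] exist for all [u] at once: bounded reals lie in a compact segment, and a cluster
   point of an ultrafilter is a limit. *)
have /choice[phi phiP] : forall u, exists l : R, ip (x n) u @[n --> U] --> l.
  move=> u; pose a := M * `|u|.
  have G : ProperFilter (ip (x n) u @[n --> U]) by exact: fmap_proper_filter.
  have [|l [_ lU]] := @segment_compact R (- a) a _ G.
    by apply: (@filterS _ U _ setT) => [n _|];
      [rewrite /= in_itv /= -ler_norml; exact: ip_le | exact: filterT].
  exists l => A lA.
  have [//|UnA] := in_ultra_setVsetC ((fun n => ip (x n) u) @^-1` A) U_ultra.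
  by have [v [/= ? ?]] := lU (~` A) A UnA lA.
have phi_le u : `|phi u| <= M * `|u|.
  apply: (cvgr_to_le (cvg_norm (phiP u))).
  by apply: (@filterS _ U _ setT) => [n _|]; [exact: ip_le | exact: filterT].
have hausR := @norm_hausdorff _ R.
have phiD u v : phi (u + v) = phi u + phi v.
  apply: (cvg_unique _ (phiP (u + v))) => //.
  rewrite (_ : (fun n => ip (x n) (u + v)) = (fun n =>
    ip (x n) u + ip (x n) v)).
    exact: cvgD (phiP u) (phiP v).
  by apply/funext => n; rewrite ipDr.
have phiZ a u : phi (a *: u) = a * phi u.
  apply: (cvg_unique _ (phiP (a *: u))) => //.
  rewrite (_ : (fun n => ip (x n) (a *: u)) = (fun n => a * ip (x n) u)).
    exact: cvgMl_tmp (phiP u).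
  by apply/funext => n; rewrite ipZr.
have [y yP] := riesz ip_norm phiD phiZ phi_le.
exists y.
(* Only the test vectors [e 0] to [e j] are controlled at stage [j], since [U] is stable under
   finite intersections only. *)
have [|k k_incr kP] := @extract_subseq (fun j n =>
    forall i, (i <= j)%N -> `|ip y (e i) - ip (x n) (e i)| < j.+1%:R^-1).
  move=> j N.
  have [n [Nn nP]] : exists n, (N <= n)%N /\ forall i, (i <= j)%N ->
      `|ip y (e i) - ip (x n) (e i)| < j.+1%:R^-1.
    apply: (@filter_ex _ U); apply: filterI; first by apply: U_oo; exists N.
    have Ulim i : U [set n | `|ip y (e i) - ip (x n) (e i)| < j.+1%:R^-1].
      rewrite -yP; move/cvgrPdist_lt : (phiP (e i)); apply.
      by rewrite invr_gt0.
    elim: {-2}j => [|m IHm].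
      by apply: filterS (Ulim 0%N) => n h i; rewrite leqn0 => /eqP ->.
    apply: filterS2 IHm (Ulim m.+1) => n IH h i.
    by rewrite leq_eqVlt => /orP[/eqP ->|] //; exact: IH.
  by exists n.
exists k => // u; apply/cvgrPdist_lt => r r0.
(* [C] exceeds every [|y - x n|], so replacing [u] by a close [e i] costs less than [r / 2]
   uniformly in [n]. *)
pose C := M + `|y| + 1.
have C0 : 0 < C by rewrite ltr_wpDl // addr_ge0.
have r20 : 0 < r / 2 by rewrite divr_gt0.
have [i ui] := e_dense u _ (divr_gt0 r20 C0).
near=> n.
have -> : ip y u - ip ((x \o k) n) u =
    ip (y - x (k n)) (u - e i) + (ip y (e i) - ip (x (k n)) (e i)).
  by rewrite /= ipBr !ipBl; ring.
rewrite (splitr r); apply: le_lt_trans (ler_normD _ _) _; apply: ltrD.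
  apply: le_lt_trans (normr_ip_le ip_norm _ _) _.
  move: ui; rewrite ltr_pdivlMr // mulrC; apply: le_lt_trans.
  rewrite ler_wpM2r //; apply: le_trans (ler_normB _ _) _.
  by rewrite /C; have := xM (k n); lra.
apply: lt_le_trans (kP n i _) _.
  by near: n; exact: nbhs_infty_ge.
apply: ltW; near: n.
exact: near_infty_natSinv_lt (PosNum r20).
Unshelve. all: by end_near. Qed.

Lemma cvg_increasing_seq (k : nat -> nat) : increasing_seq k -> k @ \oo --> \oo.
Proof.
move=> k_incr A [N _ NA]; exists N => // n Nn; apply: NA => /=.
exact: leq_trans Nn (increasing_seq_ge k_incr n).
Qed.

Lemma strong_cvg_weakly (R : realType) (H : normedModType R)
    (ip : {dot H for idfun}) (ip_norm : induces_norm ip) (x : nat -> H) y :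
  x @ \oo --> y -> weakly_cvg_to ip x y.
Proof.
move=> xy u.
exact: (continuous_cvg _ (@continuous_ipl _ _ _ ip_norm u y) xy).
Qed.

Lemma weak_cvg_unique (R : realType) (H : normedModType R)
    (ip : {dot H for idfun}) (ip_norm : induces_norm ip) (x : nat -> H) y z :
  weakly_cvg_to ip x y -> weakly_cvg_to ip x z -> y = z.
Proof.
move=> xy xz; apply/eqP; rewrite -subr_eq0 -normr_eq0 -sqrf_eq0.
rewrite (sqr_norm_ip ip_norm) ipBl subr_eq0; apply/eqP.
by apply: cvg_unique (xy (y - z)) (xz (y - z)); exact: norm_hausdorff.
Qed.

(** * Opial's lemma and strong cluster points *)

Section opial.
Context (R : realType) (H : completeNormedModType R) (ip : {dot H for idfun}).
Hypotheses (ip_norm : induces_norm ip) (H_separable : separable H).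
Implicit Types (x : nat -> H) (F : set H).

(** The identity [2 <x_n, y - z> = |x_n - z|^2 - |x_n - y|^2 + |y|^2 - |z|^2] makes [<x_n, y - z>]
    convergent along the whole sequence. Comparing the two subsequences gives
    [<y, y - z> = <z, y - z>]. *)
Lemma weak_cluster_unique x y z :
  cvg (`|x n - y| @[n --> \oo]) -> cvg (`|x n - z| @[n --> \oo]) ->
  weak_cluster ip x y -> weak_cluster ip x z -> y = z.
Proof.
move=> xy xz [k k_incr ky] [k' k'_incr kz].
have [l xl] : exists l : R, ip (x n) (y - z) @[n --> \oo] --> l.
  exists (2^-1 * (lim (`|x n - z| @[n --> \oo]) ^+ 2
                 - lim (`|x n - y| @[n --> \oo]) ^+ 2 + (`|y| ^+ 2 - `|z| ^+
                     2))).
  rewrite (_ : (fun n => _) = fun n => 2^-1 * (`|x n - z| * `|x n - z|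
      - `|x n - y| * `|x n - y| + (`|y| ^+ 2 - `|z| ^+ 2))).
    apply: cvgMl_tmp; apply: cvgD; last exact: cvg_cst.
    by apply: cvgB; apply: cvgM.
  apply/funext => n; rewrite -!expr2 !(sqr_normB ip_norm) ipBr.
  by field.
apply/eqP; rewrite -subr_eq0 -normr_eq0 -sqrf_eq0.
rewrite (sqr_norm_ip ip_norm) ipBl subr_eq0; apply/eqP.
transitivity l.
  apply: cvg_unique (ky (y - z)) _; first exact: norm_hausdorff.
  exact: (cvg_comp _ _ (cvg_increasing_seq k_incr) xl).
apply: cvg_unique _ (kz (y - z)); first exact: norm_hausdorff.
exact: (cvg_comp _ _ (cvg_increasing_seq k'_incr) xl).
Qed.

Lemma opial_weak F x : F !=set0 ->
  (forall z, F z -> cvg (`|x n - z| @[n --> \oo])) ->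
  weak_cluster ip x `<=` F -> exists2 y, F y & weakly_cvg_to ip x y.
Proof.
move=> [z0 Fz0] xF xWF.
have [M xM] : exists M, forall n, `|x n| <= M.
  have /cvg_seq_bounded[M0 [_ /(_ (M0 + 1))]] := xF _ Fz0.
  rewrite ltrDl ltr01 => /(_ isT) xM.
  exists (M0 + 1 + `|z0|) => n; rewrite -[x n](subrK z0).
  apply: le_trans (ler_normD _ _) _; rewrite lerD2r.
  by have := xM n I; rewrite /= normr_id.
have [y xy] := bounded_weak_cluster ip_norm H_separable xM.
have Fy := xWF _ xy.
(* If [y] were not the weak limit, [<x_n, u>] would stay at distance [r] from [<y, u>] along a
   subsequence for some [u]; that subsequence has its own weak cluster point, which must be [y]. *)
exists y => // u; apply: contrapT => nxu.
have [r r0 nr] : exists2 r : R, 0 < r &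
    ~ \forall n \near \oo, `|ip y u - ip (x n) u| < r.
  apply: contrapT => h; apply: nxu; apply/cvgrPdist_lt => r r0.
  by apply: contrapT => nr; apply: h; exists r.
have [|k k_incr kP] := @extract_subseq (fun _ n => r <= `|ip y u - ip (x n) u|).
  move=> _ N; apply: contrapT => h; apply: nr; exists N => // n Nn /=.
  by rewrite ltNge; apply/negP => rn; apply: h; exists n.
have [y' [k' k'_incr ky']] :=
  bounded_weak_cluster (x := x \o k) ip_norm H_separable (fun n => xM (k n)).
have xy' : weak_cluster ip x y'.
  by exists (k \o k') => // m n; exact: etrans (k_incr _ _) (k'_incr m n).
have yy' := weak_cluster_unique (xF _ Fy) (xF _ (xWF _ xy')) xy xy'.
move: (ky' u); rewrite -yy' => /cvgrPdist_lt/(_ r r0)[N _ /(_ N (leqnn N))] /=.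
by rewrite ltNge kP.
Qed.

Lemma strong_cluster_cvg x z : cvg (`|x n - z| @[n --> \oo]) ->
  strong_cluster x z -> x @ \oo --> z.
Proof.
move=> xz [k k_incr kz].
have l0 : lim (`|x n - z| @[n --> \oo]) = 0.
  rewrite -(normr0 H) -(subrr z).
  apply: (cvg_unique _ (cvg_comp _ _ (cvg_increasing_seq k_incr) xz)).
    exact: norm_hausdorff.
  by apply: cvg_norm; apply: cvgB kz _; exact: cvg_cst.
apply/cvgrPdist_lt => r r0; move: xz; rewrite /cvg_to l0.
move=> /cvgr0_norm_lt/(_ _ r0); apply: filterS => n.
by rewrite normr_id distrC.
Qed.

Lemma strong_cluster_weak x : strong_cluster x `<=` weak_cluster ip x.
Proof.
by move=> y [k k_incr ky]; exists k => //; exact: strong_cvg_weakly.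
Qed.

(* The functions [z |-> |x_n - z|] are uniformly 1-Lipschitz. *)
Lemma cvg_dist_dense F (e : nat -> H) x :
  (forall u (r : R), F u -> 0 < r -> exists i, `|u - e i| < r) ->
  (forall i, cvg (`|x n - e i| @[n --> \oo])) ->
  forall z, F z -> cvg (`|x n - z| @[n --> \oo]).
Proof.
move=> e_dense xe z Fz; apply: cauchy_cvg; apply: cauchy_exP => r r0.
have r20 : 0 < r / 2 by rewrite divr_gt0.
have [i zi] := e_dense _ _ Fz r20.
exists (lim (`|x n - e i| @[n --> \oo])).
have /cvgrPdist_lt/(_ _ r20) := xe i; apply: filterS => n /= xn.
rewrite -ball_normE /ball_ /= (splitr r).
have -> : lim (`|x n - e i| @[n --> \oo]) - `|x n - z| =
  lim (`|x n - e i| @[n --> \oo]) - `|x n - e i| + (`|x n - e i| - `|x n - z|).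
  by rewrite addrA subrK.
apply: le_lt_trans (ler_normD _ _) (ltrD xn _).
apply: le_lt_trans (ler_dist_dist _ _) _.
by rewrite opprB addrC addrA subrK.
Qed.

End opial.

(** * Measurability of random vectors *)

Section borel.
Context (R : realType) (H : normedModType R).
Context d (T : measurableType d).

Lemma measurable_open (O : set H) : open O -> measurable (O :
  set (borelType H)).
Proof. by move=> oO; apply: sub_sigma_algebra. Qed.

Lemma continuous_borel_measurable (g : H -> R) : continuous g ->
  measurable_fun [set: borelType H] (g : borelType H -> R).
Proof.
move=> /continuousP cg; apply: (measurability _ (RGenOpens.measurableE R)) =>
  //.
move=> _ [_ [a [b ->] <-]]; rewrite setTI; apply: measurable_open; apply: cg.
exact: interval_open.
Qed.

Lemma random_vector_comp (g : H -> R) (x : T -> H) : continuous g ->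
  random_vector x -> measurable_fun [set: T] (g \o x).
Proof.
move=> cg mx.
exact: (measurableT_comp (continuous_borel_measurable cg) mx).
Qed.

Lemma random_vector_norm (x : T -> H) (z : H) :
  random_vector x -> measurable_fun [set: T] (fun w => `|x w - z|).
Proof.
apply: (@random_vector_comp (fun u => `|u - z|)) => u.
by apply: cvg_norm; apply: cvgB; [exact: cvg_id | exact: cvg_cst].
Qed.

Lemma random_vector_sqr_norm (x : T -> H) :
  random_vector x -> measurable_fun [set: T] (fun w => `|x w| ^+ 2).
Proof.
move=> rx; apply: measurable_funX.
by apply: (@random_vector_comp (fun u => `|u|)) => //; exact: norm_continuous.
Qed.

End borel.

(* Closed balls are countable intersections of half-spaces because
   [|v|^2 = sup_u (2 <v, u> - |u|^2)], where [u] may range over a dense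
   sequence. *)
Lemma weakly_measurable_random_vector (R : realType) (H : normedModType R)
    (ip : {dot H for idfun}) (ip_norm : induces_norm ip) (H_separable :
      separable H)
    d (T : measurableType d) (x : T -> H) :
  (forall u, measurable_fun [set: T] (fun w => ip (x w) u)) -> random_vector x.
Proof.
move=> mx; have [e e_dense] := dense_seq H_separable.
pose B (p : nat * nat) := [set v : H | `|v - e p.1| <= p.2.+1%:R^-1].
have mB p : measurable (x @^-1` B p).
  pose r : R := p.2.+1%:R^-1.
  have -> : x @^-1` B p =
      \bigcap_k [set w | 2 * (ip (x w) (e k) - ip (e p.1) (e k)) <= r ^+ 2 +
        `|e k| ^+ 2].
    apply/seteqP; split => w /=.
      move=> xB k _ /=; rewrite -ipBl.
      have := sqr_normB ip_norm (x w - e p.1) (e k).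
      have : 0 <= `|x w - e p.1 - e k| ^+ 2 by rewrite exprn_ge0.
      have : `|x w - e p.1| ^+ 2 <= r ^+ 2.
        by rewrite ler_pXn2r ?nnegrE ?invr_ge0.
      by lra.
    move=> h; rewrite /B /= -(@ler_pXn2r _ 2) ?nnegrE ?invr_ge0 //.
    apply/ler_addgt0Pr => eps eps0.
    (* For [e k] within [sqrt eps] of [v = x w - e p.1], the number [2 <v, e k> - |e k|^2 = |v|^2 -
       |v - e k|^2] is at least [|v|^2 - eps]. *)
    have s0 : 0 < Num.sqrt eps by rewrite sqrtr_gt0.
    have [k xk] := e_dense (x w - e p.1) _ s0.
    have := h k I; rewrite /= -ipBl.
    have := sqr_normB ip_norm (x w - e p.1) (e k).
    have : `|x w - e p.1 - e k| ^+ 2 <= eps.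
      by rewrite -[leRHS]sqr_sqrtr ?(ltW eps0) // ler_pXn2r ?nnegrE ?sqrtr_ge0
        // ltW.
    rewrite -[_.2.+1%:R^-1]/r; clearbody r.
    by lra.
  apply: bigcapT_measurable => k.
  rewrite -[X in measurable X]setTI; apply: measurable_fun_le => //.
  apply: measurable_funM => //; apply: measurable_funB => //; exact: mx.
apply: (@measurability _ _ T (borelType H) setT x (@open H)) => //.
move=> _ [V V_open <-]; rewrite setTI.
(* [V] is the union of the closed balls [B p] that it contains; a radius below [r / 2] suffices by
   the triangle inequality. *)
have -> : x @^-1` V = \bigcup_(n in [set n | B (odflt (0, 0)%N (unpickle n))
  `<=` V])
    (x @^-1` B (odflt (0, 0)%N (unpickle n))).
  apply/seteqP; split => [w /= Vw|w [n /= BV]]; last exact: BV.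
  have /nbhs_ballP[r /= r0 rV] : nbhs (x w) V
    by exact: open_nbhs_nbhs (conj V_open Vw).
  have r20 : 0 < r / 2 by rewrite divr_gt0.
  have [j _ /(_ j (leqnn j)) /= jr] := near_infty_natSinv_lt (PosNum r20).
  have [i xi] : exists i, `|x w - e i| < j.+1%:R^-1.
    by apply: e_dense; rewrite invr_gt0.
  exists (pickle (i, j)); rewrite /= pickleK /B /=; last exact: ltW.
  move=> v /= vi; apply: rV; rewrite -ball_normE /ball_ /=.
  have -> : x w - v = (x w - e i) - (v - e i) by rewrite opprB addrA subrK.
  apply: le_lt_trans (ler_normB _ _) _; rewrite (splitr r).
  by apply: ltrD; [exact: lt_trans jr | exact: le_lt_trans jr].
by apply: bigcup_measurable => n _; exact: mB.
Qed.

Section random_vectors.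
Context (R : realType) (H : normedModType R) (ip : {dot H for idfun}).
Hypotheses (ip_norm : induces_norm ip) (H_separable : separable H).
Context d (T : measurableType d).
Implicit Types (x y : T -> H).

Lemma random_vector_ip x u :
  random_vector x -> measurable_fun [set: T] (fun w => ip (x w) u).
Proof.
by apply: (@random_vector_comp _ _ _ _ (ip ^~ u));
  exact: (@continuous_ipl _ _ _ ip_norm).
Qed.

(** Pairing with a fixed [u] reduces the sum to one of real functions; separability enters through
    the weak test of measurability. *)
Lemma random_vectorD x y :
  random_vector x -> random_vector y -> random_vector (fun w => x w + y w).
Proof.
move=> mx my; apply: (weakly_measurable_random_vector ip_norm H_separable) => u.
rewrite (_ : (fun w => _) = (fun w => ip (x w) u + ip (y w) u)).
  by apply: measurable_funD; exact: random_vector_ip.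
by apply/funext => w; rewrite ipDl.
Qed.

Lemma random_vectorN x : random_vector x -> random_vector (fun w => - x w).
Proof.
move=> mx; apply: (weakly_measurable_random_vector ip_norm H_separable) => u.
rewrite (_ : (fun w => _) = (fun w => - ip (x w) u)).
  by apply: measurableT_comp => //; exact: random_vector_ip.
by apply/funext => w; rewrite linearNl.
Qed.

Lemma random_vectorB x y :
  random_vector x -> random_vector y -> random_vector (fun w => x w - y w).
Proof. by move=> mx my; apply: random_vectorD => //; exact: random_vectorN. Qed.

(** The limit is picked pointwise by choice and set to [z0] on the null set [N], so that it lies in
    [F] everywhere. Measurability comes afterwards: each [<y, u>] is an everywhere limit of
    measurable functions. *)
Lemma random_vector_weak_lim (P : probability T R) (F : set H) (x :
  nat -> T -> H) :
  F !=set0 -> (forall n, random_vector (x n)) ->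
  {ae P, forall w, exists2 y, F y & weakly_cvg_to ip (x ^~ w) y} ->
  as_weakly_cvg_in P ip F x.
Proof.
move=> [z0 Fz0] mx [N [mN PN0 xN]].
have /choice[y yP] : forall w, exists y : H,
    F y /\ (if w \in N then y = z0 else weakly_cvg_to ip (x ^~ w) y).
  move=> w; have [wN|wN] := boolP (w \in N); first by exists z0.
  have [y Fy xy] : exists2 y, F y & weakly_cvg_to ip (x ^~ w) y.
    by apply: contrapT => nw; move/negP: wN; apply; rewrite inE; exact: xN.
  by exists y.
exists y; split; last 2 first.
- by move=> w; have [] := yP w.
- exists N; split => // w /= nyw; apply: contrapT => Nw; apply: nyw.
  by have [_] := yP w; rewrite memNset.
apply: (weakly_measurable_random_vector ip_norm H_separable) => u.
apply: (@measurable_fun_cvg _ _ _ _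
    (fun n w => if w \in N then ip z0 u else ip (x n w) u)).
  move=> n; apply: measurable_fun_ifT => //.
    apply: (measurable_fun_bool true); rewrite setTI.
    by rewrite preimage_mem_true.
  exact: random_vector_ip.
move=> w _; have [_] := yP w; have [wN ->|wN] := boolP (w \in N); last exact.
exact: cvg_cst.
Qed.

Lemma random_vector_strong_lim (P : probability T R) (F : set H)
    (x : nat -> T -> H) :
  F !=set0 -> (forall n, random_vector (x n)) ->
  {ae P, forall w, exists2 y, F y & x ^~ w @ \oo --> y} ->
  as_strongly_cvg_in P F x.
Proof.
move=> F0 mx xF; have [|y [my Fy xy]] := random_vector_weak_lim F0 mx (P := P).
  apply: filterS xF => w [y Fy xy]; exists y => //.
  exact: strong_cvg_weakly.
exists y; split=> //; apply: filterS2 xF xy => w [y' Fy' xy'] xy.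
by rewrite (weak_cvg_unique ip_norm xy (strong_cvg_weakly ip_norm xy')).
Qed.

End random_vectors.

(** * Conditional expectation *)

Import HBNNSimple.

(** [g] is the density of the image of the measure [f P] with respect to the image of [P]. With
    [phi] the identity onto [T] with a smaller sigma-algebra, it becomes the conditional expectation
    of [f]. *)
Lemma integrable_density d1 d2 (T1 : measurableType d1) (T2 : measurableType d2)
    (R : realType) (P : probability T1 R) (phi : {mfun T1 >-> T2})
    (f : T1 -> \bar R) :
  P.-integrable [set: T1] f -> (forall w, 0 <= f w)%E ->
  exists g : T2 -> \bar R,
    [/\ measurable_fun [set: T2] g, (forall w, (0 <= g w)%E) &
      forall A, measurable A ->
        (\int[P]_(w in phi @^-1` A) g (phi w) = \int[P]_(w in phi @^-1` A) f
          w)%E].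
Proof.
move=> intf f0.
have mphi : measurable_fun setT phi by exact: measurable_funPT.
pose nu' : {charge set T2 -> \bar R} := pushforward (induced_charge intf) phi.
pose nu := nu' mphi.
pose Q : probability T2 R := distribution P phi.
have dom : nu `<< Q.
  apply/null_content_dominatesP => A mA PA.
  have mphiA : measurable (phi @^-1` A) by exact: measurable_funPTI.
  rewrite /nu /nu' /= /pushforward /induced_charge;
    apply: null_set_integral => //.
  exact: measurable_funTS (measurable_int _ intf).
pose g := Radon_Nikodym nu Q.
have intg : Q.-integrable setT g := Radon_Nikodym_integrable dom.
have mg : measurable_fun setT g := measurable_int _ intg.
have gE A : measurable A -> (\int[Q]_(w in A) g w = nu A)%E.
  by move=> mA; rewrite -Radon_Nikodym_integral.
(* Radon-Nikodym gives the sign of [g] only almost surely: the integral of [|g|] over [A] is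
   [- nu A <= 0]. The positive part of [g] is then a version that is nonnegative everywhere. *)
pose A := [set w | (g w < 0)%E].
have mA : measurable A.
  by rewrite -[A]setTI; apply: emeasurable_fun_lt.
have [N [mN QN0 N_sub]] : ae_eq Q A g (cst 0%E).
  apply/ae_eq_integral_abs => //; first exact: measurable_funTS.
  apply/eqP; rewrite eq_le integral_ge0 ?andbT //.
  rewrite (eq_integral (fun w => - g w)%E); last first.
    by move=> w /set_mem Aw; rewrite lte0_abs.
  rewrite integralN; last first.
    have intgA : Q.-integrable A g by exact: (integrableS measurableT).
    exact: integrable_add_def intgA.
  by rewrite gE // oppe_le0 integral_ge0.
have ae_g : ae_eq Q setT g (fun w => maxe 0 (g w))%E.
  exists N; split => // w ng; apply: N_sub => /= h; apply: ng => _ /=.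
  have [//|g0] := leP 0%E (g w); exact: h.
have mg' : measurable_fun setT (fun w => maxe 0 (g w))%E.
  exact: measurable_maxe.
exists (fun w => maxe 0 (g w))%E; split => //.
  by move=> w; rewrite le_max lexx.
move=> B mB; transitivity (\int[Q]_(w in B) maxe 0 (g w))%E.
  rewrite ge0_integral_pushforward //; first exact: measurable_funTS.
  by move=> w _; rewrite le_max lexx.
rewrite (@ae_eq_integral _ _ _ Q B g) //; [|exact: measurable_funTS..|].
  exact: gE.
exact/ae_eq_sym/(ae_eq_subset _ ae_g).
Qed.

Section sub_sigma_algebra.
Context d (T : measurableType d) (R : realType) (P : probability T R).
Variable E : set (set T).
Hypothesis E_sub : is_sub_sigma_algebra E.
Implicit Types f g : T -> \bar R.

Lemma measurable_subE : (measurable : set (set (g_sigma_algebraType E))) = E.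
Proof. by apply: measurable_g_measurableTypeE; case: E_sub. Qed.

Lemma sub_sigma_measurable (A : set (g_sigma_algebraType E)) :
  measurable A -> E A.
Proof. by rewrite measurable_subE. Qed.

Lemma sub_measurable A : E A -> measurable A.
Proof. by case: E_sub => _; exact. Qed.

Lemma measurable_wrtT d' (U : measurableType d') (f : T -> U) :
  measurable_wrt E f -> measurable_fun [set: T] f.
Proof.
move=> mf _ Y mY; apply: sub_measurable; rewrite -measurable_subE.
exact: mf.
Qed.

Lemma measurable_wrt_set d' (U : measurableType d') (f : T -> U) (A : set U) :
  measurable_wrt E f -> measurable A -> E (f @^-1` A).
Proof.
by move=> mf mA; rewrite -measurable_subE -[_ @^-1` _]setTI; exact: mf.
Qed.

Lemma sub_sigmaT : E setT.
Proof. by rewrite -measurable_subE; exact: measurableT. Qed.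

Lemma sub_sigmaI A B : E A -> E B -> E (A `&` B).
Proof. by rewrite -measurable_subE; exact: measurableI. Qed.

Lemma sub_sigmaC A : E A -> E (~` A).
Proof. by rewrite -measurable_subE; exact: measurableC. Qed.

Lemma integrable_is_cond_exp f : P.-integrable [set: T] f ->
  (forall w, 0 <= f w)%E -> exists g, is_cond_exp P E f g.
Proof.
move=> intf f0.
have mid : measurable_fun [set: T] (idfun : T -> g_sigma_algebraType E).
  by move=> _ Y mY; rewrite setTI; apply: sub_measurable;
    rewrite -measurable_subE.
have [g [mg g0 gE]] := integrable_density (mfun_Sub (mem_set mid)) intf f0.
exists g; split => // A EA.
by apply: (gE A); rewrite measurable_subE.
Qed.

(** The density argument needs integrability: [f] is cut into the slices [k <= f < k + 1], bounded
    and hence integrable for a probability, and the versions are summed by monotone convergence. *)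
Lemma is_cond_exp_ex (f : T -> R) : measurable_fun [set: T] f ->
  (forall w, 0 <= f w) -> exists g, is_cond_exp P E (EFin \o f) g.
Proof.
move=> mf f0.
pose D k := f @^-1` `[k%:R, k.+1%:R[.
have mD k : measurable (D k) by rewrite /D -[X in measurable X]setTI; exact: mf.
have tD : trivIset setT D.
  apply/trivIsetP => i j _ _ /eqP ij; apply/seteqP; split => // w [].
  rewrite /D /= !in_itv /= => /andP[i1 i2] /andP[j1 j2]; apply: ij.
  by apply/eqP; rewrite eqn_leq -ltnS -(ltr_nat R) (le_lt_trans i1 j2)/=
    -ltnS -(ltr_nat R) (le_lt_trans j1 i2).
have DT : \bigcup_k D k = setT.
  apply/seteqP; split => // w _; exists (Num.truncn (f w)) => //.
  by rewrite /D /= in_itv /= truncn_itv.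
pose F k := (EFin \o f) \_ (D k).
have F0 k w : (0 <= F k w)%E.
  by rewrite /F patchE; case: ifP => // _; rewrite lee_fin.
have intF k : P.-integrable setT (F k).
  apply/integrable_restrict => //; rewrite setTI.
  apply: (@le_integrable _ _ _ P (D k) _ _ (cst k.+1%:R%:E)) => //.
  - exact/measurable_EFinP/measurable_funTS.
  - move=> w; rewrite /D /= in_itv /= => /andP[_ /ltW fk].
    by rewrite !lee_fin !ger0_norm.
  - exact: finite_measure_integrable_cst.
have /choice[g gP] k := integrable_is_cond_exp (intF k) (F0 k).
have mg k : measurable_fun setT (g k) by apply: measurable_wrtT; case: (gP k).
have g0 k w : (0 <= g k w)%E by case: (gP k).
exists (fun w => \sum_(0 <= k <oo) g k w)%E; split.
- by apply: ge0_emeasurable_sum => // k _; case: (gP k).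
- by move=> w; apply: nneseries_ge0.
move=> A EA; have mA := sub_measurable EA.
rewrite integral_nneseries //; last by move=> k; exact: measurable_funTS.
rewrite -[in RHS](setIT A) -[in RHS]DT setI_bigcupr ge0_integral_bigcup //.
- apply: eq_eseriesr => k _; case: (gP k) => _ _ gE.
  by rewrite gE // [RHS]integral_mkcondr.
- by move=> k; exact: measurableI.
- exact/measurable_funTS/measurable_EFinP.
- by move=> w _; rewrite lee_fin.
- exact: trivIset_setIl.
Qed.

Lemma cond_expP (f : T -> R) : measurable_fun [set: T] f ->
  (forall w, 0 <= f w) ->
  is_cond_exp P E (EFin \o f) (cond_exp P E (EFin \o f)).
Proof.
move=> mf f0; have [g gP] := is_cond_exp_ex mf f0.
by apply: xgetPex; exists g.
Qed.

(** Where [h < g], [h] is finite, so the exceptional set is the union of the sets [A k] of [E] on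
    which moreover [h <= k]. There [h] is integrable, subtraction is allowed, and [g - h] has zero
    integral although it is positive. *)
Lemma ae_le_sub g h : measurable_wrt E g -> measurable_wrt E h ->
  (forall w, 0 <= g w)%E -> (forall w, 0 <= h w)%E ->
  (forall A, E A -> \int[P]_(w in A) g w <= \int[P]_(w in A) h w)%E ->
  {ae P, forall w, (g w <= h w)%E}.
Proof.
move=> Eg Eh g0 h0 gh.
have mg := measurable_wrtT Eg; have mh := measurable_wrtT Eh.
pose A k := [set w | (h w < g w)%E] `&` [set w | (h w <= k%:R%:E)%E].
have EA k : E (A k).
  rewrite -measurable_subE; apply: measurableI;
    rewrite -[X in measurable X]setTI.
    exact: emeasurable_fun_lt.
  by apply: emeasurable_fun_le.
have mA k : measurable (A k) by exact: sub_measurable.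
have PA k : P.-negligible (A k).
  have hfin : (\int[P]_(w in A k) h w < +oo)%E.
    apply: (@le_lt_trans _ _ (\int[P]_(w in A k) (cst k%:R%:E) w)%E).
      apply: ge0_le_integral => //; first exact: measurable_funTS.
      by move=> w [].
    rewrite integral_cst //; apply: lte_mul_pinfty => //.
    by rewrite ltey_eq fin_num_measure.
  have gh0 w : A k w -> (0 <= g w - h w)%E.
    move=> [/= hg hk]; rewrite sube_ge0 ?ltW //.
    by rewrite ge0_fin_numE // (le_lt_trans hk) ?ltry.
  have mgh : measurable_fun (A k) (fun w => g w - h w)%E.
    by apply: measurable_funTS; exact: emeasurable_funB.
  have gE : (\int[P]_(w in A k) g w =
      \int[P]_(w in A k) h w + \int[P]_(w in A k) (g w - h w))%E.
    rewrite -ge0_integralD //; last exact: measurable_funTS.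
    apply: eq_integral => w /set_mem[/= _ hk]; rewrite addeC subeK //.
    by rewrite ge0_fin_numE // (le_lt_trans hk) ?ltry.
  have gh_eq0 : (\int[P]_(w in A k) (g w - h w) = 0)%E.
    apply/eqP; rewrite eq_le; apply/andP; split; last exact: integral_ge0.
    have := gh _ (EA k); rewrite gE -[leRHS]adde0 leeD2lE //.
    by rewrite ge0_fin_numE // integral_ge0.
  have [N [mN PN0 N_sub]] : ae_eq P (A k) (fun w => g w - h w)%E (cst 0%E).
    apply/(ae_eq_integral_abs P (mA k) mgh); rewrite -[RHS]gh_eq0.
    by apply: eq_integral => w /set_mem Aw; rewrite gee0_abs // gh0.
  exists N; split => // w Aw; apply: N_sub => /= /(_ Aw) gh_w.
  case: Aw => /= hg hk; move: hg; rewrite -sube_gt0 gh_w ltxx //.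
apply: (negligibleS _ (negligible_bigcup PA)) => w /= /negP;
  rewrite -ltNge => hg.
have hfin : h w \is a fin_num.
  by rewrite ge0_fin_numE // (lt_le_trans hg) ?leey.
exists (Num.truncn (fine (h w))).+1 => //; split => //=.
rewrite -(fineK hfin) lee_fin; apply: ltW.
have /andP[_ //] : (Num.truncn (fine (h w)))%:R <= fine (h w)
    < (Num.truncn (fine (h w))).+1%:R.
by apply: truncn_itv; rewrite fine_ge0.
Qed.

Lemma is_cond_exp_self (f : T -> R) : measurable_wrt E f ->
  (forall w, 0 <= f w) -> is_cond_exp P E (EFin \o f) (EFin \o f).
Proof. by move=> mf f0; split => //; exact/measurable_EFinP. Qed.

Lemma is_cond_exp_le f f' g g' :
  measurable_fun [set: T] f -> measurable_fun [set: T] f' ->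
  (forall w, 0 <= f w)%E -> (forall w, 0 <= f' w)%E ->
  {ae P, forall w, f w <= f' w}%E ->
  is_cond_exp P E f g -> is_cond_exp P E f' g' ->
  {ae P, forall w, g w <= g' w}%E.
Proof.
move=> mf mf' f0 f'0 ff' [mg g0 gE] [mg' g'0 g'E].
apply: ae_le_sub => // A EA; rewrite gE // g'E //.
have mA := sub_measurable EA.
apply: ae_ge0_le_integral => //; [exact: measurable_funTS..|].
by apply: filterS ff' => w ? _.
Qed.

Lemma is_cond_expD f f' g g' :
  measurable_fun [set: T] f -> measurable_fun [set: T] f' ->
  (forall w, 0 <= f w)%E -> (forall w, 0 <= f' w)%E ->
  is_cond_exp P E f g -> is_cond_exp P E f' g' ->
  is_cond_exp P E (fun w => f w + f' w)%E (fun w => g w + g' w)%E.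
Proof.
move=> mf mf' f0 f'0 [mg g0 gE] [mg' g'0 g'E]; split.
- exact: emeasurable_funD.
- by move=> w; rewrite adde_ge0.
move=> A EA; have mA := sub_measurable EA.
rewrite !ge0_integralD // ?gE ?g'E //.
all: by apply: measurable_funTS => //; exact: measurable_wrtT.
Qed.

Lemma is_cond_expZ (a : R) f g : 0 <= a ->
  measurable_fun [set: T] f -> (forall w, 0 <= f w)%E ->
  is_cond_exp P E f g ->
  is_cond_exp P E (fun w => a%:E * f w)%E (fun w => a%:E * g w)%E.
Proof.
move=> a0 mf f0 [mg g0 gE]; split.
- exact: measurable_funeM.
- by move=> w; rewrite mule_ge0 // lee_fin.
move=> A EA; have mA := sub_measurable EA.
rewrite !ge0_integralZl_EFin // ?gE //.
all: by apply: measurable_funTS => //; exact: measurable_wrtT.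
Qed.

(** For a simple weight, this exposes the sets [A] cut by a level set of [h]; they belong to [E], so
    the defining property of a conditional expectation applies on each of them. *)
Lemma integral_nnsfunM (h : {nnsfun g_sigma_algebraType E >-> R}) f A : E A ->
  measurable_fun [set: T] f -> (forall w, 0 <= f w)%E ->
  (\int[P]_(w in A) ((h w)%:E * f w) =
   \sum_(y \in range h) y%:E * \int[P]_(w in A `&` h @^-1` [set y]) f w)%E.
Proof.
move=> EA mf f0; have mA := sub_measurable EA.
have mh y : measurable (h @^-1` [set y] : set T).
  by apply/sub_measurable/sub_sigma_measurable; exact: measurable_sfunP.
transitivity (\int[P]_(w in A) (\sum_(y \in range h)
    (y * \1_(h @^-1` [set y]) w)%:E * f w))%E.
  apply: eq_integral => w _.
  by rewrite -ge0_mule_fsuml ?fsumEFin // -?fimfunE // => y;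
    exact: nnfun_muleindic_ge0.
have mind y : measurable_fun A (fun w => (y * \1_(h @^-1` [set y]) w)%:E).
  apply: measurable_funTS; apply/measurable_EFinP; exact: measurable_funM.
rewrite ge0_integral_fsum //; last 2 first.
- by move=> y; apply: emeasurable_funM => //; exact: measurable_funTS.
- by move=> y w _; rewrite mule_ge0 // nnfun_muleindic_ge0.
apply: eq_fsbigr => y /set_mem[w0 _ hw0].
have y0 : 0 <= y by rewrite -hw0.
under eq_integral do rewrite EFinM -muleA.
rewrite ge0_integralZl_EFin //.
- rewrite integral_mkcondr; congr (_ * _)%E; apply: eq_integral => w _.
  by rewrite epatch_indic muleC.
- by move=> w _; rewrite mule_ge0 // lee_fin.
- apply: emeasurable_funM; last exact: measurable_funTS.
  by apply: measurable_funTS; apply/measurable_EFinP.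
Qed.

(* Positivity of [u] avoids the products [0 * +oo] in the limit. *)
Lemma is_cond_expM (u : T -> R) f g : measurable_wrt E u ->
  (forall w, 0 < u w) ->
  measurable_fun [set: T] f -> (forall w, 0 <= f w)%E ->
  is_cond_exp P E f g ->
  forall A, E A -> (\int[P]_(w in A) ((u w)%:E * g w) =
                   \int[P]_(w in A) ((u w)%:E * f w))%E.
Proof.
move=> mu u0 mf f0 [mg g0 gE] A EA; have mA := sub_measurable EA.
have mEu : measurable_fun [set: g_sigma_algebraType E] (EFin \o u).
  exact/measurable_EFinP.
pose h n : {nnsfun g_sigma_algebraType E >-> R} := nnsfun_approx measurableT
  mEu n.
have mh n : measurable_fun [set: T] (h n).
  by apply: measurable_wrtT; exact: measurable_funPT.
(* Simple [E]-measurable functions increase to [u]; stating the limit for any [k] serves both [f]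
   and [g]. *)
have lim_h k : (forall w, 0 <= k w)%E -> measurable_fun [set: T] k ->
    (\int[P]_(w in A) ((u w)%:E * k w) =
     limn (fun n => \int[P]_(w in A) ((h n w)%:E * k w)))%E.
  move=> k0 mk.
  rewrite -monotone_convergence //.
  - apply: eq_integral => w _; apply/esym/cvg_lim => //; apply: cvgeM.
    + by rewrite /mule_def; case: (k w) => //; rewrite gt_eqF.
    + apply: (cvg_nnsfun_approx measurableT mEu) => // v _.
      by rewrite lee_fin ltW.
    + exact: cvg_cst.
  - move=> n; apply: measurable_funTS; apply: emeasurable_funM => //.
    exact/measurable_EFinP.
  - by move=> n w _; rewrite mule_ge0 // lee_fin.
  - move=> w _ m n mn; rewrite lee_wpmul2r // lee_fin.
    by have /lefP/(_ w) := nd_nnsfun_approx measurableT mEu mn.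
rewrite !lim_h //; last exact: measurable_wrtT.
congr (limn _); apply/funext => n.
rewrite !integral_nnsfunM //; last exact: measurable_wrtT.
apply: eq_fsbigr => y _; congr (_ * _)%E; apply: gE; apply: sub_sigmaI => //.
by apply: sub_sigma_measurable; exact: measurable_sfunP.
Qed.

End sub_sigma_algebra.

(** * Convergence of nonnegative supermartingales *)

Section crossings.
Context (R : realType) (a b : R) (z : nat -> R).

(* Buy one unit of [z] when it drops below [a], sell it when it exceeds [b]. *)
Fixpoint holding (n : nat) : bool :=
  if n is m.+1 then if holding m then z n <= b else z n < a else z 0 < a.

Fixpoint sales (n : nat) : nat :=
  if n is m.+1 then (sales m + (holding m && (b < z n)%R))%N else 0%N.

Fixpoint wealth (n : nat) : R :=
  if n is m.+1 then wealth m + (if holding m then z n - z m else 0) else a.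

(** An invariant: a held unit is valued at its price, idle capital at [a]. Buying replaces [a] by a
    lower price; selling replaces a price above [b] by [a] and books [b - a]. *)
Lemma sales_le_wealth n :
  (sales n)%:R * (b - a) + (if holding n then z n else a) <= wealth n.
Proof.
elim: n => [|n IHn] /=.
  by rewrite mul0r add0r; case: ifP => // /ltW.
move: IHn; case: (holding n) => /=; rewrite ?addn0 ?addr0; last first.
  by case: (ltP (z n.+1) a) => // /ltW; lra.
case: leP => zb; rewrite ?addn0 ?addn1 -?natr1; first by lra.
by rewrite mulrDl mul1r; lra.
Qed.

Lemma sales_nondecreasing : {homo sales : m n / (m <= n)%N}.
Proof.
by apply: homo_leq => [//|m n p|n /=]; [exact: leq_trans | exact: leq_addr].
Qed.

(** After the last sale, either a unit is held at some time and never sold, so [z] does not exceed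
    [b] any more, or nothing is ever held, so [z] does not drop below [a]. *)
Lemma bounded_sales_dichotomy (M : nat) : (forall n, (sales n <= M)%N) ->
  (\forall n \near \oo, z n <= b) \/ (\forall n \near \oo, a <= z n).
Proof.
move=> salesM.
have [N salesN] : exists N, forall n, (N <= n)%N -> sales n = sales N.
  have ex : exists m, `[<exists n, sales n = m>] by exists (sales 0%N);
    apply/asboolP; exists 0%N.
  have bd m : `[<exists n, sales n = m>] -> (m <= M)%N.
    by move=> /asboolP[n <-].
  have [m /asboolP[N sN] mmax] := ex_maxnP ex bd.
  exists N => n Nn; apply/eqP; rewrite eqn_leq; apply/andP; split;
    first by rewrite sN; apply: mmax; apply/asboolP; exists n.
  exact: sales_nondecreasing.
have [[n [Nn hn]]|nh] := pselect (exists n, (N <= n)%N /\ holding n).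
  left; have hold k : holding (n + k) /\ z (n + k).+1 <= b.
    elim: k => [|k [hk zk]].
      rewrite addn0; split => //; rewrite leNgt; apply/negP => zb.
      have := salesN n.+1 (leqW Nn); rewrite /= hn zb (salesN n Nn).
      by move/eqP; rewrite -[X in _ == X]addn0 eqn_add2l.
    have Nk : (N <= n + k.+1)%N by rewrite (leq_trans Nn) ?leq_addr.
    have hk1 : holding (n + k.+1) by rewrite addnS /= hk.
    split => //; rewrite leNgt; apply/negP => zb.
    have := salesN _ (leqW Nk); rewrite /= hk1 zb (salesN _ Nk).
    by move/eqP; rewrite -[X in _ == X]addn0 eqn_add2l.
  exists n.+1 => // k /= nk.
  by have [_] := hold (k - n.+1)%N; rewrite -addSn subnKC.
right; exists N.+1 => // -[//|n] /= Nn; rewrite leNgt; apply/negP => za.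
apply: nh; have [hn|hn] := boolP (holding n); first by exists n.
by exists n.+1; rewrite leqW //= (negbTE hn).
Qed.

End crossings.

(** The limit is the lower limit [sup S], finite by the frequent bound [M]. Two rationals are
    inserted between [sup S] and [sup S + e]: the smaller one exceeds [sup S], so it is no eventual
    lower bound, and the dichotomy makes the larger one an eventual upper bound. *)
Lemma cvg_of_dichotomies (R : realType) (z : nat -> R) (M : R) :
  (forall n, 0 <= z n) ->
  (forall N, exists2 n, (N <= n)%N & z n <= M) ->
  (forall p q : rat, 0 < p -> p < q ->
    (\forall n \near \oo, z n <= ratr q) \/ (\forall n \near \oo, ratr p <= z
      n)) ->
  cvg (z @ \oo).
Proof.
move=> z0 zM dich; pose S := [set a | \forall n \near \oo, a <= z n].
have S0 : S 0 by apply: nearW.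
have supS : has_sup S.
  split; first by exists 0.
  exists M => a [N _ Na]; have [n Nn zn] := zM N.
  exact: le_trans (Na n Nn) zn.
have l0 : 0 <= sup S by apply: ub_le_sup => //; case: supS.
apply/cvg_ex; exists (sup S); apply/cvgrPdist_lt => e e0.
have [s Ss sl] := sup_adherent e0 supS.
have Se : sup S < sup S + e by rewrite ltrDl.
have [q1 /=] := rat_in_itvoo Se.
rewrite in_itv /= => /andP[lq1 q1e].
have [q2 /=] := rat_in_itvoo q1e.
rewrite in_itv /= => /andP[q12 q2e].
have up : \forall n \near \oo, z n <= ratr q2.
  have q10 : 0 < q1 by rewrite -(ltr0q R); exact: le_lt_trans lq1.
  have q12' : q1 < q2 by rewrite -(ltr_rat R).
  have [//|Sq1] := dich q1 q2 q10 q12'.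
  have : ratr q1 <= sup S by apply: ub_le_sup => //; case: supS.
  by rewrite leNgt lq1.
apply: filterS2 Ss up => n sn nq.
rewrite ltr_distlC; apply/andP; split; first exact: lt_le_trans sl sn.
exact: le_lt_trans nq q2e.
Qed.

Lemma integral_lty_ae d (T : measurableType d) (R : realType)
    (P : probability T R) (f : T -> \bar R) :
  measurable_fun [set: T] f -> (forall w, 0 <= f w)%E ->
  (\int[P]_w f w < +oo)%E -> {ae P, forall w, (f w < +oo)%E}.
Proof.
move=> mf f0 intf; have [|N [mN PN N_sub]] := @integrable_ae _ _ _ P _
  measurableT f.
  apply/integrableP; split => //.
  by rewrite (eq_integral f) // => w _; rewrite gee0_abs.
exists N; split => // w /= fw; apply: N_sub => /= /(_ I).
by rewrite ge0_fin_numE.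
Qed.

Lemma ae_forall_count d (T : measurableType d) (R : realType)
    (P : probability T R) (I : countType) (Q : I -> T -> Prop) :
  (forall i, {ae P, forall w, Q i w}) -> {ae P, forall w, forall i, Q i w}.
Proof.
move=> PQ; pose Q' n w := if unpickle n is Some i then Q i w else True.
have : {ae P, forall w, forall n, Q' n w}.
  apply: ae_foralln => n; rewrite /Q'; case: unpickle => [i|]; first exact: PQ.
  exact: aeW.
by apply: filterS => w Qw i; have := Qw (pickle i); rewrite /Q' pickleK.
Qed.

(** By Fatou's lemma the lower limit of [f n] has finite integral, so it is almost surely finite,
    and [f n] cannot eventually exceed it by more than 1. This serves both for the supermartingale
    and for its number of sales. *)
Lemma ae_frequently_bounded d (T : measurableType d) (R : realType)
    (P : probability T R) (f : nat -> T -> R) (C : R) :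
  (forall n, measurable_fun [set: T] (f n)) -> (forall n w, 0 <= f n w) ->
  (forall n, \int[P]_w (f n w)%:E <= C%:E)%E ->
  {ae P, forall w, exists M, forall N, exists2 n, (N <= n)%N & f n w <= M}.
Proof.
move=> mf f0 fC.
pose F n w := (f n w)%:E.
have mF n : measurable_fun [set: T] (F n) by exact/measurable_EFinP.
have F0 n w : (0 <= F n w)%E by rewrite lee_fin.
have le_liminf : (\int[P]_w limn_einf (F ^~ w) <= C%:E)%E.
  apply: le_trans (fatou P measurableT mF (fun n w _ => F0 n w)) _.
  rewrite limn_einf_lim; apply: lime_le; first exact: is_cvg_einfs.
  apply: nearW => n; apply: le_trans (fC n).
  by apply: ereal_inf_lbound; exists n => /=.
have liminf_ge0 w : (0 <= limn_einf (F ^~ w))%E.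
  rewrite limn_einf_lim; apply: lime_ge; first exact: is_cvg_einfs.
  by apply: nearW => n; apply: le_ereal_inf_tmp => _ [k _ <-].
have mlim : measurable_fun [set: T] (fun w => limn_einf (F ^~ w)).
  rewrite /limn_einf; apply: measurableT_comp => //.
  by apply: measurable_fun_limn_esup => n; exact: measurableT_comp.
have [N [mN PN N_sub]] :=
  integral_lty_ae mlim liminf_ge0 (le_lt_trans le_liminf (ltry _)).
exists N; split => // w /= nb; apply: N_sub => /= liminf_lty; apply: nb.
have liminf_fin : limn_einf (F ^~ w) \is a fin_num by rewrite ge0_fin_numE.
exists (fine (limn_einf (F ^~ w)) + 1) => N0.
apply: contrapT => nb.
suff : (limn_einf (F ^~ w) + 1%:E <= limn_einf (F ^~ w))%E.
  by rewrite -[X in (_ <= X)%E -> _]adde0 leeD2lE // lee_fin ler10.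
rewrite {2}limn_einf_lim; apply: lime_ge; first exact: is_cvg_einfs.
exists N0 => // n /= N0n; apply: le_ereal_inf_tmp => _ [k /= nk <-].
rewrite -(fineK liminf_fin) -EFinD lee_fin leNgt; apply/negP => fk.
by apply: nb; exists k; [exact: leq_trans nk|exact: ltW].
Qed.

Section filtration.
Context d (T : measurableType d) (R : realType) (P : probability T R).
Variable X : nat -> set (set T).
Hypothesis X_sub : forall n, is_sub_sigma_algebra (X n).
Hypothesis X_incr : forall n, X n `<=` X n.+1.

Lemma filtration_mono m n : (m <= n)%N -> X m `<=` X n.
Proof.
move=> /subnK <-; elim: (n - m)%N => [//|k IHk] A XA.
by rewrite addSn; apply: X_incr; exact: IHk.
Qed.

Lemma measurable_wrt_mono m n d' (U : measurableType d') (f : T -> U) :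
  (m <= n)%N -> measurable_wrt (X m) f -> measurable_wrt (X n) f.
Proof.
move=> mn mf _ A mA; rewrite setTI.
apply: sub_sigma_algebra; apply: (filtration_mono mn).
exact: measurable_wrt_set mf mA.
Qed.

Definition adapted (f : nat -> T -> R) := forall n, measurable_wrt (X n) (f n).

Lemma adapted_holding a b (z : nat -> T -> R) n : adapted z ->
  measurable_wrt (X n) (fun w => holding a b (z ^~ w) n).
Proof.
move=> mz; rewrite /measurable_wrt; elim: n => [|n IHn] /=.
  by apply: measurable_fun_ltr => //; exact: mz.
apply: measurable_fun_ifT.
- exact: (measurable_wrt_mono (leqnSn n) IHn).
- by apply: measurable_fun_ler => //; exact: mz.
- by apply: measurable_fun_ltr => //; exact: mz.
Qed.

Lemma adapted_wealth a b (z : nat -> T -> R) : adapted z ->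
  adapted (fun n w => wealth a b (z ^~ w) n).
Proof.
move=> mz n; rewrite /measurable_wrt; elim: n => [|n IHn] /=;
  first exact: measurable_cst.
apply: measurable_funD; first exact: (measurable_wrt_mono (leqnSn n) IHn).
apply: measurable_fun_ifT => //.
- exact: (measurable_wrt_mono (leqnSn n) (adapted_holding a b mz)).
- apply: measurable_funB; first exact: mz.
  exact: (measurable_wrt_mono (leqnSn n) (@mz n)).
Qed.

Lemma adapted_sales a b (z : nat -> T -> R) : adapted z ->
  adapted (fun n w => (sales a b (z ^~ w) n)%:R).
Proof.
move=> mz n; rewrite /measurable_wrt; elim: n => [|n IHn] /=;
  first exact: measurable_cst.
rewrite (_ : (fun _ => _) = (fun w => (sales a b (z ^~ w) n)%:R +
    if holding a b (z ^~ w) n then if b < z n.+1 w then 1 else 0 else 0)).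
  apply: measurable_funD; first exact: (measurable_wrt_mono (leqnSn n) IHn).
  apply: measurable_fun_ifT => //.
    exact: (measurable_wrt_mono (leqnSn n) (adapted_holding a b mz)).
  apply: measurable_fun_ifT => //.
  by apply: measurable_fun_ltr => //; exact: mz.
by apply/funext => w; rewrite natrD; case: holding => //=; case: ltP.
Qed.

Section supermartingale.
Variable z : nat -> T -> R.
Hypotheses (z_adapted : adapted z) (z_ge0 : forall n w, 0 <= z n w).
Hypothesis z0_int : (\int[P]_w (z 0%N w)%:E < +oo)%E.
Hypothesis z_super : forall n A, X n A ->
  (\int[P]_(w in A) (z n.+1 w)%:E <= \int[P]_(w in A) (z n w)%:E)%E.

Let mz n : measurable_fun [set: T] (z n).
Proof. exact: (measurable_wrtT (X_sub n) (@z_adapted n)). Qed.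

Lemma supermartingale_integral_le n :
  (\int[P]_w (z n w)%:E <= \int[P]_w (z 0%N w)%:E)%E.
Proof.
elim: n => [//|n IHn]; apply: le_trans IHn; apply: z_super.
exact: sub_sigmaT.
Qed.

(** Wealth changes by [z n.+1 - z n] on the event [H] of holding at time [n], which belongs to
    [X n]. Adding the finite integral of [z n] over [H] to both sides avoids integrating a signed
    increment. *)
Lemma wealth_integral_le (a b : R) n : 0 <= a -> a <= b ->
  (\int[P]_w (wealth a b (z ^~ w) n)%:E <= a%:E)%E.
Proof.
move=> a0 ab; pose W n w := wealth a b (z ^~ w) n.
pose h n w := holding a b (z ^~ w) n.
have W0 k w : 0 <= W k w.
  apply: le_trans (sales_le_wealth a b (z ^~ w) k).
  by rewrite addr_ge0 ?mulr_ge0 ?subr_ge0 //; case: ifP.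
have mW k : measurable_fun [set: T] (EFin \o W k).
  by apply/measurable_EFinP; exact: (measurable_wrtT (X_sub k)
    (@adapted_wealth a b z z_adapted k)).
elim: n => [|n IHn].
  have -> : (fun w => (wealth a b (z ^~ w) 0)%:E) = cst a%:E by [].
  by rewrite integral_cst // [X in (_ * X)%E]probability_setT mule1.
apply: le_trans IHn.
pose H := [set w | h n w].
have XH : X n H.
  have -> : H = h n @^-1` [set true] by [].
  exact: (measurable_wrt_set (X_sub n) (adapted_holding a b z_adapted)).
have mH := sub_measurable (X_sub n) XH.
have hz k : (\int[P]_w (if h n w then (z k w)%:E else 0) =
    \int[P]_(w in H) (z k w)%:E)%E.
  rewrite [RHS]integral_mkcond; apply: eq_integral => w _.
  by rewrite patchE mem_setE.
have mhz k : measurable_fun [set: T] (fun w =>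
  if h n w then (z k w)%:E else 0%E).
  apply: measurable_fun_ifT => //; last exact/measurable_EFinP.
  exact: (measurable_wrtT (X_sub n) (adapted_holding a b z_adapted)).
have hz0 k w : (0 <= if h n w then (z k w)%:E else 0)%E.
  by case: ifP => // _; rewrite lee_fin.
have Hfin : (\int[P]_(w in H) (z n w)%:E)%E \is a fin_num.
  rewrite ge0_fin_numE; last by apply: integral_ge0 => w _; rewrite lee_fin.
  apply: le_lt_trans z0_int; apply: le_trans (supermartingale_integral_le n).
  by apply: ge0_subset_integral => //; [exact/measurable_EFinP|move=> w _;
    rewrite lee_fin].
rewrite -(leeD2rE _ _ Hfin).
apply: (@le_trans _ _ (\int[P]_w (W n w)%:E + \int[P]_(w in H) (z n.+1
  w)%:E)%E).
  rewrite -!hz -!ge0_integralD //; last 4 first.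
  - by move=> w _; rewrite lee_fin W0.
  - exact: mW.
  - by move=> w _; rewrite lee_fin (W0 n.+1).
  - exact: (mW n.+1).
  apply: ge0_le_integral => //.
  - by move=> w _; rewrite adde_ge0 // lee_fin (W0 n.+1).
  - by apply: emeasurable_funD => //; exact: (mW n.+1).
  - by apply: emeasurable_funD => //; exact: (mW n).
  move=> w _; rewrite /W /h /=; case: ifP => _;
    rewrite ?addr0 // -!EFinD lee_fin.
  by rewrite -addrA subrK.
by apply: leeD2l; exact: z_super.
Qed.

Lemma supermartingale_cvg : {ae P, forall w, cvg (z ^~ w @ \oo)}.
Proof.
pose C := fine (\int[P]_w (z 0%N w)%:E).
have CE : (\int[P]_w (z 0%N w)%:E = C%:E)%E.
  by rewrite fineK // ge0_fin_numE // integral_ge0 // => w _; rewrite lee_fin.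
have bnd : {ae P, forall w, exists M, forall N, exists2 n, (N <= n)%N & z n w
  <= M}.
  apply: (ae_frequently_bounded (C := C)) => // n.
  by rewrite -CE; exact: supermartingale_integral_le.
have dich (pq : rat * rat) : {ae P, forall w, 0 < pq.1 -> pq.1 < pq.2 ->
    (\forall n \near \oo, z n w <= ratr pq.2) \/
    (\forall n \near \oo, ratr pq.1 <= z n w)}.
  have [/andP[p0 pq_lt]|npq] := boolP ((0 < pq.1) && (pq.1 < pq.2)); last first.
    by apply: aeW => w p0 pq_lt; move: npq; rewrite p0 pq_lt.
  set a : R := ratr pq.1; set b : R := ratr pq.2.
  have a0 : 0 <= a by rewrite ler0q ltW.
  have ab : a < b by rewrite ltr_rat.
  (* The expected number of sales is at most [a / (b - a)] for every [n]. As the count is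
     nondecreasing in [n], a frequent bound is a bound. *)
  have : {ae P, forall w, exists M, forall N, exists2 n, (N <= n)%N &
      (sales a b (z ^~ w) n)%:R <= M :> R}.
    apply: (ae_frequently_bounded (C := a / (b - a))) => // n.
      exact: (measurable_wrtT (X_sub n) (@adapted_sales a b z z_adapted n)).
    have ba0 : 0 < b - a by rewrite subr_gt0.
    rewrite -(@lee_pmul2l _ (b - a)%:E) //.
    rewrite -EFinM mulrC divfK ?gt_eqF // -ge0_integralZl_EFin //; last 2 first.
    - by apply/measurable_EFinP; exact: (measurable_wrtT (X_sub n)
        (@adapted_sales a b z z_adapted n)).
    - exact: ltW.
    apply: le_trans (wealth_integral_le n a0 (ltW ab)).
    apply: ge0_le_integral => //.
    - by move=> w _; rewrite -EFinM lee_fin mulr_ge0 // ltW.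
    - apply/measurable_EFinP; apply: measurable_funM => //.
      exact: (measurable_wrtT (X_sub n) (@adapted_sales a b z z_adapted n)).
    - apply/measurable_EFinP.
      exact: (measurable_wrtT (X_sub n) (@adapted_wealth a b z z_adapted n)).
    - move=> w _; rewrite -EFinM lee_fin mulrC.
      apply: le_trans (sales_le_wealth a b (z ^~ w) n).
      by rewrite lerDl; case: ifP.
  apply: filterS => w [M salesM] _ _.
  apply: (bounded_sales_dichotomy (M := Num.truncn M)).
  move=> n; have [k nk kM] := salesM n.
  apply: leq_trans (sales_nondecreasing a b (z ^~ w) nk) _.
  have M0 : 0 <= M by exact: le_trans kM.
  have /andP[_ Mlt] := truncn_itv M0.
  by rewrite -ltnS -(ltr_nat R); exact: le_lt_trans kM Mlt.
have dich' : {ae P, forall w, forall pq : rat * rat, 0 < pq.1 -> pq.1 < pq.2 ->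
    (\forall n \near \oo, z n w <= ratr pq.2) \/
    (\forall n \near \oo, ratr pq.1 <= z n w)}.
  exact: ae_forall_count.
apply: filterS2 bnd dich' => w [M zM] dichw.
apply: (cvg_of_dichotomies (M := M)) => // p q.
exact: (dichw (p, q)).
Qed.

End supermartingale.

End filtration.

(** * Almost supermartingales *)

(** For nonnegative terms this is summability, phrased in the reals to suit linear arithmetic. *)
Definition bounded_sums (R : realType) (u : nat -> R) :=
  exists M, forall n, \sum_(k < n) u k <= M.

Lemma nondecreasing_sums (R : realType) (u : nat -> R) : (forall k, 0 <= u k) ->
  nondecreasing_seq (fun n => \sum_(k < n) u k).
Proof.
by move=> u0; apply/nondecreasing_seqP => n; rewrite big_ord_recr /= lerDl.
Qed.

Lemma bounded_sums_cvg (R : realType) (u : nat -> R) : (forall k, 0 <= u k) ->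
  bounded_sums u -> cvg ((\sum_(k < n) u k) @[n --> \oo]).
Proof.
move=> u0 [M uM]; apply: nondecreasing_is_cvgn; first exact: nondecreasing_sums.
by exists M => _ [n _ <-].
Qed.

Section filtration.
Context d (T : measurableType d) (R : realType) (P : probability T R).
Variable X : nat -> set (set T).
Hypothesis X_sub : forall n, is_sub_sigma_algebra (X n).
Hypothesis X_incr : forall n, X n `<=` X n.+1.

Lemma adapted_sum (f : nat -> T -> R) n : adapted X f ->
  measurable_wrt (X n) (fun w => \sum_(k < n.+1) f k w).
Proof.
move=> mf; rewrite /measurable_wrt; elim: n => [|n IHn].
  under eq_fun do rewrite big_ord1; exact: mf.
under eq_fun do rewrite big_ord_recr /=.
apply: measurable_funD; last exact: mf.
exact: (measurable_wrt_mono X_sub X_incr (leqnSn n) IHn).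
Qed.

(** * The Robbins-Siegmund theorem without the factors [1 + chi_n] *)

Section driftless.
Variables a v e : nat -> T -> R.
Hypotheses (a_adapted : adapted X a) (v_adapted : adapted X v)
  (e_adapted : adapted X e).
Hypotheses (a_ge0 : forall n w, 0 <= a n w) (v_ge0 : forall n w, 0 <= v n w)
  (e_ge0 : forall n w, 0 <= e n w).
Hypothesis a0_int : (\int[P]_w (a 0%N w)%:E < +oo)%E.
Hypothesis a_super : forall n A, X n A ->
  (\int[P]_(w in A) (a n.+1 w + v n w)%:E <=
   \int[P]_(w in A) (a n w + e n w)%:E)%E.

(* The process [a + sum v + K - sum e], stopped before [sum e] exceeds [K]. *)
Let stopped (K : R) := fix z n w := if n is m.+1 then
  if \sum_(k < n) e k w <= K
  then a n w + \sum_(k < n) v k w + (K - \sum_(k < n) e k w) else z m w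
  else a 0%N w + K.

Let stoppedE (K : R) n w : \sum_(k < n.+1) e k w <= K ->
  stopped K n w = a n w + \sum_(k < n) v k w + (K - \sum_(k < n) e k w).
Proof.
case: n => [|n] eK /=; first by rewrite !big_ord0 addr0 subr0.
by rewrite ifT //; apply: le_trans eK; rewrite [leRHS]big_ord_recr lerDl /=.
Qed.

Let stopped_ge0 (K : R) n w : 0 <= K -> 0 <= stopped K n w.
Proof.
move=> K0; elim: n => [|n IHn]; rewrite [stopped _ _ _]/=;
  first by rewrite addr_ge0.
case: ifP => // eK; apply: addr_ge0; last by rewrite subr_ge0.
by rewrite addr_ge0 // sumr_ge0.
Qed.

Let stopped_adapted (K : R) : adapted X (stopped K).
Proof.
move=> n; rewrite /measurable_wrt; elim: n => [|n IHn].
  by apply: measurable_funD => //; exact: a_adapted.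
have mS (f : nat -> T -> R) : adapted X f -> measurable_wrt (X n.+1) (fun w =>
  \sum_(k < n.+1) f k w).
  by move=> mf; exact: (measurable_wrt_mono X_sub X_incr (leqnSn n)
    (adapted_sum mf)).
rewrite [stopped _ _]/=; apply: measurable_fun_ifT.
- by apply: measurable_fun_ler => //; exact: (mS e).
- apply: measurable_funD; first by apply: measurable_funD;
    [exact: a_adapted | exact: (mS v)].
  by apply: measurable_funB => //; exact: (mS e).
- exact: (measurable_wrt_mono X_sub X_incr (leqnSn n) IHn).
Qed.

Let stopped_super (K : R) n A : 0 <= K -> X n A ->
  (\int[P]_(w in A) (stopped K n.+1 w)%:E <=
   \int[P]_(w in A) (stopped K n w)%:E)%E.
Proof.
move=> K0 XA.
(* The event that the process still moves between times [n] and [n.+1]. The sum ends at [e n], so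
   this is known at time [n]. *)
pose D := [set w | \sum_(k < n.+1) e k w <= K].
have XD : X n D.
  apply: (sub_sigma_measurable (X_sub n)).
  rewrite -[D]setTI; apply: measurable_fun_le => //.
  exact: adapted_sum e_adapted.
have m_stop k : measurable_fun [set: T] (EFin \o stopped K k).
  by apply/measurable_EFinP; exact: (measurable_wrtT (X_sub k)
    (@stopped_adapted K k)).
have XAD := sub_sigmaI (X_sub n) XA XD.
have XAC := sub_sigmaI (X_sub n) XA (sub_sigmaC (X_sub n) XD).
have mAD := sub_measurable (X_sub n) XAD.
have mAC := sub_measurable (X_sub n) XAC.
have split k : (\int[P]_(w in A) (stopped K k w)%:E =
    \int[P]_(w in A `&` D) (stopped K k w)%:E +
    \int[P]_(w in A `&` ~` D) (stopped K k w)%:E)%E.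
  rewrite -ge0_integral_setU //.
  - by rewrite -setIUr setUCr setIT.
  - by rewrite -setIUr setUCr setIT; apply: measurable_funTS; exact: m_stop.
  - by move=> w _; rewrite lee_fin stopped_ge0.
  - by rewrite disj_set2E setIACA setICr setI0.
rewrite !split; apply: leeD; last first.
  rewrite (@eq_integral _ _ _ P _ (EFin \o stopped K n)) // => w.
  by rewrite inE => -[_ /= /negP Dw]; rewrite /= (negbTE Dw).
(* The part common to both sides: on [D] the process is [a n.+1 + v n + r] at time [n.+1] and
   [a n + e n + r] at time [n]. As [r >= 0] there, its integral can be split off. *)
pose r w := \sum_(k < n) v k w + (K - \sum_(k < n.+1) e k w).
have r0 w : D w -> 0 <= r w.
  by move=> Dw; rewrite addr_ge0 ?subr_ge0 // sumr_ge0.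
have mv : measurable_fun [set: T] (fun w => \sum_(k < n) v k w).
  by apply: measurable_sum => k; exact:
    (measurable_wrtT (X_sub k) (@v_adapted k)).
have mr : measurable_fun [set: T] r.
  apply: measurable_funD => //; apply: measurable_funB => //.
  exact: (measurable_wrtT (X_sub n) (adapted_sum e_adapted)).
have ma k : measurable_fun [set: T] (a k) by exact:
  (measurable_wrtT (X_sub k) (@a_adapted k)).
rewrite (@eq_integral _ _ _ P _ (fun w =>
  (a n.+1 w + v n w)%:E + (r w)%:E)%E); last first.
  move=> w; rewrite inE => -[_ Dw]; rewrite /= Dw -EFinD; congr (_%:E).
  by rewrite big_ord_recr /r /=; ring.
rewrite [leRHS](@eq_integral _ _ _ P _ (fun w =>
  (a n w + e n w)%:E + (r w)%:E)%E); last first.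
  move=> w; rewrite inE => -[_ Dw]; rewrite stoppedE // -EFinD; congr (_%:E).
  by rewrite /r [X in _ = _ + (_ + (K - X))]big_ord_recr /=; ring.
rewrite !ge0_integralD //.
- by apply: leeD2r; exact: a_super.
all: try by move=> w [_ ?]; rewrite lee_fin ?r0 // addr_ge0.
all: apply: measurable_funTS; apply/measurable_EFinP => //.
all: apply: measurable_funD => //.
- exact: (measurable_wrtT (X_sub n) (@e_adapted n)).
- exact: (measurable_wrtT (X_sub n) (@v_adapted n)).
Qed.

(** The bound on [sum e] is random, so stopping is done at every integer level [K]. For a given [w]
    and [K] above its bound the process never stops, hence [a + sum v] converges; [a >= 0] then
    bounds [sum v]. *)
Lemma driftless_almost_supermartingale :
  {ae P, forall w, bounded_sums (e ^~ w)} ->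
  {ae P, forall w, cvg (a ^~ w @ \oo) /\ bounded_sums (v ^~ w)}.
Proof.
move=> e_sum.
have stop_cvg : {ae P, forall w, forall K : nat, cvg (stopped K%:R ^~ w @ \oo)}.
  apply: ae_forall_count => K.
  apply: (supermartingale_cvg X_sub X_incr).
  - exact: stopped_adapted.
  - by move=> n w; exact: stopped_ge0.
  - rewrite /=; under eq_integral do rewrite EFinD.
    rewrite ge0_integralD //; last 2 first.
    + by move=> w _; rewrite lee_fin.
    + by apply/measurable_EFinP; exact: (measurable_wrtT (X_sub 0%N)
      (@a_adapted 0%N)).
    by rewrite lte_add_pinfty // integral_cst // [X in (_ *
      X)%E]probability_setT mule1 ltry.
  - by move=> n A XA; exact: stopped_super.
apply: filterS2 e_sum stop_cvg => w [M eM] zcvg.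
pose K := (Num.truncn (Num.max M 0)).+1.
have MK : M <= K%:R.
  have /andP[_] : (Num.truncn (Num.max M 0))%:R <= Num.max M 0 < K%:R.
    by apply: truncn_itv; rewrite le_max lexx orbT.
  by move=> /ltW; apply: le_trans; rewrite le_max lexx.
have stopE n := @stoppedE K%:R n w (le_trans (eM n.+1) MK).
have S_cvg : cvg ((\sum_(k < n) e k w) @[n --> \oo]).
  by apply: (@bounded_sums_cvg R (e ^~ w)) => //; exists M.
have Y_cvg : cvg ((a n w + \sum_(k < n) v k w) @[n --> \oo]).
  rewrite (_ : (fun n => _) = (fun n => stopped K%:R n w + (\sum_(k < n) e k w
    - K%:R))).
    by apply: is_cvgD => //; apply: is_cvgB => //; exact: is_cvg_cst.
  by apply/funext => n; rewrite stopE; ring.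
have v_sum : bounded_sums (v ^~ w).
  have /cvg_seq_bounded[N [_ /(_ (N + 1))]] := Y_cvg.
  rewrite ltrDl ltr01 => /(_ isT) YN; exists (N + 1) => n.
  apply: le_trans (YN n I); apply: le_trans (ler_norm _).
  by rewrite lerDr.
split => //.
rewrite (_ : a ^~ w = (fun n => (a n w + \sum_(k < n) v k w) - \sum_(k < n) v
  k w)).
  by apply: is_cvgB => //; exact: (@bounded_sums_cvg R (v ^~ w)).
by apply/funext => n; rewrite addrK.
Qed.

End driftless.

Lemma bounded_sumsS (u v : nat -> R) : (forall n, u n <= v n) ->
  bounded_sums v -> bounded_sums u.
Proof.
move=> uv [M vM]; exists M => n; apply: le_trans (vM n).
by apply: ler_sum => k _; exact: uv.
Qed.

Lemma bounded_sumsZ (c : R) (u : nat -> R) : 0 <= c ->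
  bounded_sums u -> bounded_sums (fun n => c * u n).
Proof.
by move=> c0 [M uM]; exists (c * M) => n; rewrite -mulr_sumr ler_wpM2l.
Qed.

(* Robbins and Siegmund.  The weights [exp (- sum chi)] absorb the factors
   [1 + chi_n], because [1 + chi_n <= exp chi_n]. *)
Lemma almost_supermartingale (alpha chi eps theta : nat -> T -> R) :
  adapted X alpha -> adapted X chi -> adapted X eps -> adapted X theta ->
  (forall n w, 0 <= alpha n w) -> (forall n w, 0 <= chi n w) ->
  (forall n w, 0 <= eps n w) -> (forall n w, 0 <= theta n w) ->
  (\int[P]_w (alpha 0%N w)%:E < +oo)%E ->
  (forall n, exists2 g, is_cond_exp P (X n) (EFin \o alpha n.+1) g &
    {ae P, forall w, g w + (theta n w)%:E <=
      ((1 + chi n w) * alpha n w + eps n w)%:E}%E) ->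
  {ae P, forall w, bounded_sums (chi ^~ w)} ->
  {ae P, forall w, bounded_sums (eps ^~ w)} ->
  {ae P, forall w, cvg (alpha ^~ w @ \oo) /\ bounded_sums (theta ^~ w)}.
Proof.
move=> mal mchi meps mth al0 chi0 eps0 th0 al0_int al_super chi_sum eps_sum.
(* The sum ends at index [n - 1], so [p n.+1] is known at time [n] and passes through the
   conditional expectation given [X n]. *)
pose p n w := expR (- \sum_(k < n) chi k w).
have p_gt0 n w : 0 < p n w by exact: expR_gt0.
have p_le1 n w : p n w <= 1 by rewrite -expR0 ler_expR oppr_le0 sumr_ge0.
have mp1 n : measurable_wrt (X n) (p n.+1).
  rewrite /measurable_wrt /p; apply: measurableT_comp => //.
  by apply: measurableT_comp => //; exact: (adapted_sum mchi).
have mp : adapted X p.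
  case=> [|n]; last exact: (measurable_wrt_mono X_sub X_incr (leqnSn n) (mp1
    n)).
  rewrite /measurable_wrt (_ : p 0%N = cst 1) //.
  by apply/funext => w; rewrite /p big_ord0 oppr0 expR0.
have p_chi n w : p n.+1 w * (1 + chi n w) <= p n w.
  have -> : p n w = p n.+1 w * expR (chi n w).
    by rewrite /p -expRD big_ord_recr /=; congr expR; ring.
  by rewrite ler_pM2l // expR_ge1Dx.
have mT (f : T -> R) n : measurable_wrt (X n) f -> measurable_fun [set: T] f.
  by move=> mf; exact: (measurable_wrtT (X_sub n) mf).
have main : {ae P, forall w, cvg ((p n w * alpha n w) @[n --> \oo]) /\
    bounded_sums (fun n => p n.+1 w * theta n w)}.
  apply: (@driftless_almost_supermartingale _ _ (fun n w =>
    p n.+1 w * eps n w)).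
  - by move=> n; apply: measurable_funM; [exact: mp | exact: mal].
  - by move=> n; apply: measurable_funM; [exact: mp1 | exact: mth].
  - by move=> n; apply: measurable_funM; [exact: mp1 | exact: meps].
  - by move=> n w; rewrite mulr_ge0 // ltW.
  - by move=> n w; rewrite mulr_ge0 // ltW.
  - by move=> n w; rewrite mulr_ge0 // ltW.
  - apply: le_lt_trans al0_int; apply: ge0_le_integral => //.
    + by move=> w _; rewrite lee_fin mulr_ge0 // ltW.
    + apply/measurable_EFinP/(mT _ 0%N); apply: measurable_funM;
      [exact: mp | exact: mal].
    + by apply/measurable_EFinP/(mT _ 0%N); exact: mal.
    + by move=> w _; rewrite lee_fin ler_piMl.
  - move=> n A XA; have mA := sub_measurable (X_sub n) XA.
    have [g gP g_le] := al_super n; have [mg g0 _] := gP.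
    have mpn := mT _ _ (mp1 n).
    have mthn : measurable_fun [set: T] (theta n) by apply: (mT _ n);
      exact: mth.
    have maln k : measurable_fun [set: T] (alpha k) by apply: (mT _ k);
      exact: mal.
    have mgT : measurable_fun [set: T] g := measurable_wrtT (X_sub n) mg.
    have mpg : measurable_fun A (fun w => (p n.+1 w)%:E * g w)%E.
      apply: measurable_funTS; apply: emeasurable_funM => //.
      exact/measurable_EFinP.
    have mpth : measurable_fun A (fun w => (p n.+1 w * theta n w)%:E).
      by apply/measurable_funTS/measurable_EFinP; exact: measurable_funM.
    have -> : (\int[P]_(w in A) (p n.+1 w * alpha n.+1 w + p n.+1 w * theta n
      w)%:E =
        \int[P]_(w in A) ((p n.+1 w)%:E * g w + (p n.+1 w * theta n w)%:E))%E.
      under eq_integral do rewrite EFinD.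
      rewrite !ge0_integralD //.
      - congr (_ + _)%E.
        rewrite (is_cond_expM (X_sub n) (mp1 n) (p_gt0 n.+1) _ _ gP XA).
        + by apply: eq_integral => w _; rewrite -EFinM.
        + exact/measurable_EFinP.
        + by move=> w; rewrite lee_fin.
      - by move=> w _; rewrite mule_ge0 // lee_fin ltW.
      - by move=> w _; rewrite lee_fin mulr_ge0 // ltW.
      - by move=> w _; rewrite lee_fin mulr_ge0 // ltW.
      - by apply/measurable_funTS/measurable_EFinP; exact: measurable_funM.
      - by move=> w _; rewrite lee_fin mulr_ge0 // ltW.
    apply: ae_ge0_le_integral => //.
    + by move=> w _; rewrite adde_ge0 // ?mule_ge0 // lee_fin ?mulr_ge0 // ltW.
    + exact: emeasurable_funD.
    + by move=> w _; rewrite lee_fin addr_ge0 // mulr_ge0 // ltW.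
    + apply/measurable_funTS/measurable_EFinP/(mT _ n).
      apply: measurable_funD; apply: measurable_funM;
        [exact: mp | exact: mal | exact: mp1 | exact: meps].
    apply: filterS g_le => w g_le _.
    rewrite EFinM -muleDr //; last by rewrite ge0_adde_def // inE ?lee_fin.
    have -> : (p n w * alpha n w + p n.+1 w * eps n w)%:E =
        ((p n w * alpha n w - p n.+1 w * ((1 + chi n w) * alpha n w))%:E +
         (p n.+1 w)%:E * ((1 + chi n w) * alpha n w + eps n w)%:E)%E.
      by rewrite -EFinM -EFinD; congr (_%:E); ring.
    apply: (@le_trans _ _ ((p n.+1 w)%:E * ((1 + chi n w) * alpha n w + eps n
      w)%:E)%E).
      by apply: lee_wpmul2l => //; rewrite lee_fin ltW.
    by rewrite leeDr // lee_fin subr_ge0 mulrA ler_wpM2r.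
  apply: filterS eps_sum => w; apply: bounded_sumsS => n.
  by rewrite ler_piMl.
(* The weights are undone pathwise: [exp (sum chi)] converges and stays below [exp M]. *)
apply: filterS2 chi_sum main => w chiw [cvg_pal sum_pth].
have cvg_chi := bounded_sums_cvg (fun k => chi0 k w) chiw.
split.
  rewrite (_ : alpha ^~ w = fun n => expR (\sum_(k < n) chi k w) * (p n w *
    alpha n w)).
    apply: is_cvgM => //; apply/cvg_ex; eexists.
    by apply: continuous_cvg; [exact: continuous_expR | exact: cvg_chi].
  by apply/funext => n; rewrite mulrA /p -expRD subrr expR0 mul1r.
have [M chiM] := chiw.
apply: (bounded_sumsS _ (bounded_sumsZ (expR_ge0 M) sum_pth)) => n.
rewrite mulrA ler_peMl // /p -expRD -expR0 ler_expR subr_ge0; exact: chiM.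
Qed.

End filtration.

(** * Summable sequences and the descent estimate *)

Section bounded_sums.
Context (R : realType).
Implicit Types u v b : nat -> R.

Lemma bounded_sumsD u v : bounded_sums u -> bounded_sums v ->
  bounded_sums (fun n => u n + v n).
Proof.
by move=> [M uM] [N vN]; exists (M + N) => n; rewrite big_split lerD.
Qed.

Lemma bounded_sums_le u : (forall n, 0 <= u n) -> bounded_sums u ->
  exists2 B, 0 <= B & forall n, u n <= B.
Proof.
move=> u0 [M uM]; exists M => [|n]; first by have := uM 0%N; rewrite big_ord0.
by apply: le_trans (uM n.+1); rewrite big_ord_recr lerDr sumr_ge0.
Qed.

Lemma bounded_sumsM b u (B : R) : 0 <= B -> (forall n, b n <= B) ->
  (forall n, 0 <= u n) -> bounded_sums u -> bounded_sums (fun n => b n * u n).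
Proof.
move=> B0 bB u0 /(bounded_sumsZ B0); apply: bounded_sumsS => n.
exact: ler_wpM2r.
Qed.

Lemma bounded_sums_sqr u : (forall n, 0 <= u n) -> bounded_sums u ->
  bounded_sums (fun n => u n ^+ 2).
Proof.
move=> u0 su; have [B B0 uB] := bounded_sums_le u0 su.
exact: (bounded_sumsM B0 uB).
Qed.

Lemma bounded_sums_geometric : bounded_sums (fun n => 2^-1 ^+ n : R).
Proof.
exists 2 => n; suff -> : \sum_(k < n) (2^-1 ^+ k : R) = 2 - 2 * 2^-1 ^+ n.
  by rewrite lerBlDr lerDl mulr_ge0 // exprn_ge0.
elim: n => [|n IHn]; first by rewrite big_ord0 expr0; ring.
by rewrite big_ord_recr /= IHn exprS; field.
Qed.

Lemma bounded_sums_nneseries u : (forall n, 0 <= u n) ->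
  bounded_sums u <-> (\sum_(0 <= n <oo) (u n)%:E < +oo)%E.
Proof.
move=> u0; have sumE n : (\sum_(0 <= k < n) (u k)%:E = (\sum_(k < n) u k)%:E)%E.
  by rewrite sumEFin big_mkord.
have u0' n : (0 <= n)%N -> true -> (0 <= (u n)%:E)%E by rewrite lee_fin.
split=> [[M uM]|fin_sum].
  apply: (@le_lt_trans _ _ M%:E); last exact: ltry.
  apply: lime_le; first exact: is_cvg_nneseries.
  by apply: nearW => n; rewrite sumE lee_fin.
have sum_fin : (\sum_(0 <= n <oo) (u n)%:E)%E \is a fin_num.
  by rewrite ge0_fin_numE // nneseries_ge0.
exists (fine (\sum_(0 <= n <oo) (u n)%:E)%E) => n.
rewrite -lee_fin fineK // -sumE.
exact: nneseries_lim_ge.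
Qed.

(* One step of the descent estimate: [a'] and [y] stand for the conditional
   second moments of [x_{n+1} - z] and [x_n + l (t_n - x_n) - z], and [g], [h]
   for [l sqrt(E |c_n|^2)] and [sqrt(l E |d_n|^2)]. *)
Lemma descent_step (l a a' y tau t sd s g h c2 d2 theta1 theta2
    mu1 mu2 nu1 nu2 r : R) :
  let eta := g + r in let zeta := h + r in
  let rho := l * mu1 + (1 + mu1) * (l * mu2) + (1 + mu1) * (1 + mu2) * zeta in
  let kappa := (1 + mu1) * (1 + zeta) * (l * nu2) + (1 + mu1) * (h ^+ 2 + h)
    + l * nu1 in
  0 < l <= 1 -> 0 <= a -> 0 <= s -> 0 <= tau -> 0 <= g -> 0 <= h -> 0 < r ->
  0 <= theta1 -> 0 <= theta2 -> 0 <= mu1 -> 0 <= mu2 -> 0 <= nu1 -> 0 <= nu2 ->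
  g ^+ 2 = l ^+ 2 * c2 -> h ^+ 2 = l * d2 ->
  a' <= (1 + eta) * y + (1 + eta^-1) * (l ^+ 2 * c2) ->
  y + l * (1 - l) * tau <= (1 - l) * a + l * t ->
  t + theta1 <= (1 + mu1) * sd + nu1 ->
  sd <= (1 + zeta) * s + (1 + zeta^-1) * d2 ->
  s + theta2 <= (1 + mu2) * a + nu2 ->
  a' + (l * (1 - l) * tau + l * theta1 + l * theta2) <=
    (1 + (eta + rho + eta * rho)) * a + ((1 + eta) * kappa + g ^+ 2 + g).
Proof.
move=> eta zeta rho kappa /andP[l0 l1] a0 s0 tau0 g0 h0 r0 th10 th20 mu10 mu20.
move=> nu10 nu20 gE hE a'_le y_le t_le sd_le s_le.
have eta0 : 0 < eta by rewrite ltr_wpDl.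
have zeta0 : 0 < zeta by rewrite ltr_wpDl.
have g_eta : eta^-1 * g ^+ 2 <= g.
  rewrite expr2 mulrA ler_piMl // mulrC ler_pdivrMr // mul1r /eta lerDl.
  exact: ltW.
have h_zeta : zeta^-1 * h ^+ 2 <= h.
  rewrite expr2 mulrA ler_piMl // mulrC ler_pdivrMr // mul1r /zeta lerDl.
  exact: ltW.
have t_le2 : l * t + l * theta1 + l * theta2 <= (l + rho) * a + kappa.
  have h1 : (1 + mu1) * (l * sd) <=
      (1 + mu1) * ((1 + zeta) * (l * s) + (h ^+ 2 + h)).
    apply: ler_wpM2l; first by rewrite addr_ge0.
    have := ler_wpM2l (ltW l0) sd_le; rewrite mulrDr.
    have -> : l * ((1 + zeta^-1) * d2) = h ^+ 2 + zeta^-1 * h ^+ 2.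
      by rewrite hE; ring.
    by have := h_zeta; lra.
  have h2 : (1 + mu1) * (1 + zeta) * (l * s + l * theta2) <=
      (1 + mu1) * (1 + zeta) * ((1 + mu2) * (l * a) + l * nu2).
    apply: ler_wpM2l; first by rewrite mulr_ge0 // addr_ge0 // ltW.
    by have := ler_wpM2l (ltW l0) s_le; rewrite !mulrDr; lra.
  have h3 : l * theta2 <= (1 + mu1) * (1 + zeta) * (l * theta2).
    apply: ler_peMl; first by rewrite mulr_ge0 // ltW.
    by have := mulr_ge0 mu10 (ltW zeta0); rewrite mulrDl mul1r;
      have := ltW zeta0; lra.
  (* [zeta] is summable by itself, so its factor [l] is dropped by [l <= 1]. *)
  have h4 : l * zeta * ((1 + mu1) * (1 + mu2) * a) <=
      zeta * ((1 + mu1) * (1 + mu2) * a).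
    apply: ler_wpM2r; first by rewrite !mulr_ge0 // addr_ge0.
    by rewrite ler_piMl // ltW.
  have := ler_wpM2l (ltW l0) t_le; rewrite /rho /kappa.
  by clear -h1 h2 h3 h4; lra.
have y_le2 : y + l * (1 - l) * tau + l * theta1 + l * theta2 <=
    (1 + rho) * a + kappa by lra.
(* The terms to be kept on the left are nonnegative, so they only grow when [y_le2] is multiplied by
   [1 + eta]. *)
have ext0 : 0 <= l * (1 - l) * tau + l * theta1 + l * theta2.
  rewrite !addr_ge0 // ?mulr_ge0 ?subr_ge0 // ltW //.
have := ler_wpM2l (ltW (ltr_pwDl ltr01 (ltW eta0))) y_le2.
have : l * (1 - l) * tau + l * theta1 + l * theta2 <=
    (1 + eta) * (l * (1 - l) * tau + l * theta1 + l * theta2).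
  by rewrite ler_peMl // lerDl ltW.
rewrite -gE in a'_le.
by clear -a'_le g_eta; lra.
Qed.

End bounded_sums.

(** * Conditional inequalities *)

Section conditional_inequalities.
Context d (T : measurableType d) (R : realType) (P : probability T R).
Variable E : set (set T).
Hypothesis E_sub : is_sub_sigma_algebra E.
Implicit Types f : T -> R.

Local Notation ce f := (cond_exp P E (fun w => (f w)%:E)).

Lemma cond_exp_ge0 f : measurable_fun [set: T] f -> (forall w, 0 <= f w) ->
  forall w, (0 <= ce f w)%E.
Proof. by move=> mf f0; have [] := cond_expP P E_sub mf f0. Qed.

Lemma cond_exp_measurable f : measurable_fun [set:
  T] f -> (forall w, 0 <= f w) ->
  measurable_wrt E (fun w => fine (ce f w)).
Proof.
move=> mf f0; have [mg _ _] := cond_expP P E_sub mf f0.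
rewrite /measurable_wrt; apply: measurableT_comp; last exact: mg.
exact: fine_measurable.
Qed.

Lemma cond_exp_lty f : measurable_fun [set: T] f -> (forall w, 0 <= f w) ->
  (\int[P]_w (f w)%:E < +oo)%E -> {ae P, forall w, ce f w \is a fin_num}.
Proof.
move=> mf f0 intf; have [mg g0 gE] := cond_expP P E_sub mf f0.
have := @integral_lty_ae _ _ _ P _ (measurable_wrtT E_sub mg) g0.
rewrite gE; last exact: sub_sigmaT.
by move=> /(_ intf); apply: filterS => w gw; rewrite ge0_fin_numE.
Qed.

Lemma cond_exp_le_self f : measurable_wrt E f -> (forall w, 0 <= f w) ->
  {ae P, forall w, (ce f w <= (f w)%:E)%E}.
Proof.
move=> mf f0; have mfT := measurable_wrtT E_sub mf.
have mfE : measurable_fun [set: T] (EFin \o f) by exact/measurable_EFinP.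
apply: (is_cond_exp_le E_sub mfE mfE _ _ _ (cond_expP P E_sub mfT f0)
  (is_cond_exp_self P mf f0)) => [w|w|]; rewrite ?lee_fin //.
exact: aeW.
Qed.

(** The term [b f'] sits on the left because possibly infinite conditional expectations cannot be
    subtracted; [b = 0] gives the form needed for Young's inequality. *)
Lemma cond_exp_le_linear f f' f1 f2 (b a1 a2 : R) :
  measurable_fun [set: T] f -> measurable_fun [set: T] f' ->
  measurable_fun [set: T] f1 -> measurable_fun [set: T] f2 ->
  (forall w, 0 <= f w) -> (forall w, 0 <= f' w) ->
  (forall w, 0 <= f1 w) -> (forall w, 0 <= f2 w) ->
  0 <= b -> 0 <= a1 -> 0 <= a2 ->
  {ae P, forall w, f w + b * f' w <= a1 * f1 w + a2 * f2 w} ->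
  {ae P, forall w,
    (ce f w + b%:E * ce f' w <= a1%:E * ce f1 w + a2%:E * ce f2 w)%E}.
Proof.
move=> mf mf' mf1 mf2 f0 f'0 f10 f20 b0 a10 a20 f_le.
have mE (g : T -> R) : measurable_fun [set: T] g -> measurable_fun [set:
  T] (EFin \o g).
  by move=> mg; exact/measurable_EFinP.
have mZ (a : R) (g : T -> R) : measurable_fun [set: T] g ->
    measurable_fun [set: T] (fun w => a%:E * (EFin \o g) w)%E.
  by move=> mg; apply: measurable_funeM; exact: mE.
have E0 (g : T -> R) : (forall w, 0 <= g w) -> forall w, (0 <= (EFin \o g) w)%E.
  by move=> g0 w; rewrite lee_fin.
have Z0 (a : R) (g : T -> R) : 0 <= a -> (forall w, 0 <= g w) ->
    forall w, (0 <= a%:E * (EFin \o g) w)%E.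
  by move=> a0 g0 w; rewrite mule_ge0 // lee_fin.
have lhs := is_cond_expD E_sub (mE _ mf) (mZ b _ mf') (E0 _ f0) (Z0 b _ b0 f'0)
  (cond_expP P E_sub mf f0)
  (is_cond_expZ E_sub b0 (mE _ mf') (E0 _ f'0) (cond_expP P E_sub mf' f'0)).
have rhs := is_cond_expD E_sub (mZ a1 _ mf1) (mZ a2 _ mf2) (Z0 a1 _ a10 f10)
  (Z0 a2 _ a20 f20)
  (is_cond_expZ E_sub a10 (mE _ mf1) (E0 _ f10) (cond_expP P E_sub mf1 f10))
  (is_cond_expZ E_sub a20 (mE _ mf2) (E0 _ f20) (cond_expP P E_sub mf2 f20)).
apply: (is_cond_exp_le E_sub _ _ _ _ _ lhs rhs).
- by apply: emeasurable_funD; [exact: mE | exact: mZ].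
- by apply: emeasurable_funD; exact: mZ.
- by move=> w; rewrite adde_ge0 //; [exact: E0 | exact: Z0].
- by move=> w; rewrite adde_ge0 //; exact: Z0.
- by apply: filterS f_le => w; rewrite -!EFinM -!EFinD lee_fin.
Qed.

End conditional_inequalities.

(** * Young's inequality and its conditional form *)

Section young.
Context (R : realType) (H : normedModType R).

Lemma sqr_normD_young (u v : H) (e : R) : 0 < e ->
  `|u + v| ^+ 2 <= (1 + e) * `|u| ^+ 2 + (1 + e^-1) * `|v| ^+ 2.
Proof.
move=> e0.
apply: (@le_trans _ _ ((`|u| + `|v|) ^+ 2)).
  by rewrite ler_pXn2r ?nnegrE ?addr_ge0 // ler_normD.
rewrite -subr_ge0.
have -> : (1 + e) * `|u| ^+ 2 + (1 + e^-1) * `|v| ^+ 2 - (`|u| + `|v|) ^+ 2 =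
    e^-1 * (e * `|u| - `|v|) ^+ 2.
  by field; rewrite gt_eqF.
by rewrite mulr_ge0 ?sqr_ge0 // invr_ge0 ltW.
Qed.

Context d (T : measurableType d) (P : probability T R).
Variable E : set (set T).
Hypothesis E_sub : is_sub_sigma_algebra E.

Local Notation ce f := (cond_exp P E (fun w => (f w)%:E)).

(* The null set must not depend on [e], which will be random: it is first
   obtained for rational [e]. *)
Lemma cond_exp_young (f f1 f2 : T -> R) (k : R) : 0 <= k ->
  measurable_fun [set: T] f -> measurable_fun [set: T] f1 ->
  measurable_fun [set: T] f2 ->
  (forall w, 0 <= f w) -> (forall w, 0 <= f1 w) -> (forall w, 0 <= f2 w) ->
  {ae P, forall w, forall e : R, 0 < e -> f w <= (1 + e) * f1 w + (1 + e^-1) *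
    (k * f2 w)} ->
  {ae P, forall w, ce f1 w \is a fin_num -> ce f2 w \is a fin_num ->
    ce f w \is a fin_num /\ forall e : R, 0 < e ->
    fine (ce f w) <= (1 + e) * fine (ce f1 w) + (1 + e^-1) * (k * fine (ce f2
      w))}.
Proof.
move=> k0 mf mf1 mf2 f0 f10 f20 f_le.
have ae_rat : {ae P, forall w, forall q : rat, 0 < q ->
    (ce f w <= (1 + ratr q)%:E * ce f1 w + ((1 + (ratr q)^-1) * k)%:E * ce f2
      w)%E}.
  apply: ae_forall_count => q.
  have [q0|q0] := boolP (0 < q); last by apply: aeW.
  have rq0 : 0 < ratr q :> R by rewrite ltr0q.
  have a1 : 0 <= 1 + ratr q :> R by rewrite addr_ge0 // ltW.
  have a2 : 0 <= (1 + (ratr q)^-1) * k :> R by rewrite mulr_ge0 // addr_ge0 //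
    invr_ge0 ltW.
  have := @cond_exp_le_linear _ _ _ P E E_sub f f f1 f2 0 (1 + ratr q)
    ((1 + (ratr q)^-1) * k) mf mf mf1 mf2 f0 f0 f10 f20 (lexx 0) a1 a2.
  have f_le_q : {ae P, forall w,
      f w + 0 * f w <= (1 + ratr q) * f1 w + (1 + (ratr q)^-1) * k * f2 w}.
    by apply: filterS f_le => w /(_ _ rq0); rewrite mul0r addr0 mulrA.
  by move=> /(_ f_le_q); apply: filterS => w; rewrite mul0e adde0 => + _.
apply: filterS ae_rat => w le_rat fin1 fin2.
have g0 := cond_exp_ge0 P E_sub mf f0 w.
have g10 : 0 <= fine (ce f1 w) by rewrite fine_ge0 // cond_exp_ge0.
have g20 : 0 <= fine (ce f2 w) by rewrite fine_ge0 // cond_exp_ge0.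
have fin0 : ce f w \is a fin_num.
  rewrite ge0_fin_numE //; apply: le_lt_trans (le_rat 1 ltr01) _.
  by rewrite -(fineK fin1) -(fineK fin2) -!EFinM -EFinD ltry.
split => // e e0.
apply/ler_addgt0Pr => r r0.
(* A rational just above [e] raises the first term by at most [r] and lowers the term with the
   inverse. *)
have er : e < e + r / (fine (ce f1 w) + 1).
  by rewrite ltrDl divr_gt0 // ltr_wpDl.
have [q] := rat_in_itvoo er; rewrite in_itv /= => /andP[eq qr].
have rq0 : 0 < ratr q :> R by exact: lt_trans eq.
have q0 : 0 < q by rewrite -(ltr0q R).
have := le_rat q q0.
rewrite -[X in (X <= _)%E](fineK fin0) -(fineK fin1) -(fineK fin2) -!EFinM
  -EFinD lee_fin !fineK //.
move=> /le_trans; apply.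
have : (ratr q)^-1 * (k * fine (ce f2 w)) <= e^-1 * (k * fine (ce f2 w)).
  by rewrite ler_wpM2r ?mulr_ge0 // lef_pV2 ?posrE // ltW.
have : ratr q * fine (ce f1 w) <= e * fine (ce f1 w) + r.
  apply: (@le_trans _ _ ((e + r / (fine (ce f1 w) + 1)) * fine (ce f1 w))).
    by rewrite ler_wpM2r // ltW.
  rewrite mulrDl lerD2l -mulrA; apply: ler_piMr; first exact: ltW.
  by rewrite mulrC ler_pdivrMr ?ltr_wpDl // mul1r lerDl.
by lra.
Qed.

End young.

Lemma integral_sqr_normB_lty (R : realType) (H : normedModType R)
    (ip : {dot H for idfun}) (ip_norm : induces_norm ip)
    (H_separable : separable H) d (T : measurableType d) (P : probability T R)
    (u v : T -> H) :
  in_L2 P u -> in_L2 P v -> (\int[P]_w (`|u w - v w| ^+ 2)%:E < +oo)%E.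
Proof.
move=> [mu intu] [mv intv].
have msq (y : T -> H) : random_vector y ->
    measurable_fun [set: T] (fun w => (`|y w| ^+ 2)%:E).
  by move=> my; apply/measurable_EFinP; exact: random_vector_sqr_norm.
apply: (@le_lt_trans _ _ (\int[P]_w (2%:E * (`|u w| ^+ 2)%:E + 2%:E * (`|v w|
  ^+ 2)%:E))%E).
  apply: ge0_le_integral => //.
  - by apply: msq; exact: (random_vectorB ip_norm H_separable).
  - by apply: emeasurable_funD; apply: measurable_funeM; exact: msq.
  - move=> w _; rewrite -!EFinM -EFinD lee_fin.
    have := sqr_normD_young (u w) (- v w) ltr01.
    by rewrite invr1 normrN -natr1.
have sq0 (y : T -> H) w : (0 <= (`|y w| ^+ 2)%:E)%E by rewrite lee_fin
  exprn_ge0.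
have m2sq (y : T -> H) : random_vector y ->
    measurable_fun [set: T] (fun w => 2%:E * (`|y w| ^+ 2)%:E)%E.
  by move=> my; apply: measurable_funeM; exact: msq.
rewrite (ge0_integralD P measurableT) => [|w _||w _|]; try exact: m2sq;
  last 2 first.
- by rewrite mule_ge0.
- by rewrite mule_ge0.
rewrite (ge0_integralZl_EFin _ measurableT _ (msq _ mu)) //.
rewrite (ge0_integralZl_EFin _ measurableT _ (msq _ mv)) //.
by rewrite lte_add_pinfty // lte_mul_pinfty.
Qed.

(** * The stochastic quasi-Fejer property *)

(** The variables [s n] are not assumed square integrable: the finiteness of their conditional
    moments is read off the inequality of (d). *)
Lemma fin_num_leD (R : realType) (a : \bar R) (b c : R) :
  (0 <= a)%E -> 0 <= b ->
  (a + b%:E <= c%:E)%E -> a \is a fin_num.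
Proof.
move=> a0 b0 abc; rewrite ge0_fin_numE //; apply: le_lt_trans (ltry c).
by apply: le_trans abc; rewrite leeDl // lee_fin.
Qed.

Section stochastic_fejer.
Context (R : realType) (H : completeNormedModType R) (ip : {dot H for idfun}).
Hypotheses (ip_norm : induces_norm ip) (H_separable : separable H).
Context (disp : measure_display) (T : measurableType disp) (P :
  probability T R).
Variables (lambda : nat -> R) (x t c d : nat -> T -> H) (X :
  nat -> set (set T)).
Hypothesis lambda_itv : forall n, 0 < lambda n <= 1.
Hypotheses (x_L2 : forall n, in_L2 P (x n)) (t_L2 : forall n, in_L2 P (t n))
  (c_L2 : forall n, in_L2 P (c n)) (d_L2 : forall n, in_L2 P (d n)).
Hypotheses (X_sub : forall n, is_sub_sigma_algebra (X n))
  (X_x : forall n,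
    g_sigma_preimage (fun i : 'I_n.+1 => (x i : T -> borelType H)) `<=` X n)
  (X_incr : forall n, X n `<=` X n.+1).
Hypothesis x_rec : forall n, {ae P, forall w,
  x n.+1 w = x n w + lambda n *: (t n w + c n w - x n w)}.

Local Notation ce n f := (cond_exp P (X n) (fun w => (f w)%:E)).
Local Notation sqn u := (fun w => `|u w| ^+ 2).

Hypotheses (c_sum : {ae P, forall w, (\sum_(0 <= n <oo)
    (lambda n)%:E * sqrte (ce n (sqn (c n)) w) < +oo)%E})
  (d_sum : {ae P, forall w, (\sum_(0 <= n <oo)
    sqrte ((lambda n)%:E * ce n (sqn (d n)) w) < +oo)%E}).

Variables (z : H) (s : nat -> T -> H).
Variables theta1 theta2 mu1 mu2 nu1 nu2 : nat -> T -> R.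
Hypothesis s_rv : forall n, random_vector (s n).
Hypotheses (theta1_ell : ell_plus X theta1) (theta2_ell : ell_plus X theta2)
  (mu1_ell : ell_plus_oo P X mu1) (mu2_ell : ell_plus_oo P X mu2)
  (nu1_ell : ell_plus_oo P X nu1) (nu2_ell : ell_plus_oo P X nu2).
Hypotheses
  (lmu1_ell : ell_plus_p P 1 X (fun n w => lambda n * mu1 n w))
  (lmu2_ell : ell_plus_p P 1 X (fun n w => lambda n * mu2 n w))
  (lnu1_ell : ell_plus_p P (1 / 2) X (fun n w => lambda n * nu1 n w))
  (lnu2_ell : ell_plus_p P (1 / 2) X (fun n w => lambda n * nu2 n w)).
Hypothesis t_ineq : forall n, {ae P, forall w,
  (ce n (fun v => `|t n v - z| ^+ 2) w + (theta1 n w)%:E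
   <= (1 + mu1 n w)%:E * ce n (fun v => `|s n v + d n v| ^+ 2) w
      + (nu1 n w)%:E)%E}.
Hypothesis s_ineq : forall n, {ae P, forall w,
  (ce n (sqn (s n)) w + (theta2 n w)%:E
   <= ((1 + mu2 n w) * `|x n w - z| ^+ 2 + nu2 n w)%:E)%E}.

Let alpha n w := `|x n w - z| ^+ 2.
Let tau n w := fine (ce n (fun v => `|t n v - x n v| ^+ 2) w).
Let g n w := lambda n * Num.sqrt (fine (ce n (sqn (c n)) w)).
Let h n w := Num.sqrt (lambda n * fine (ce n (sqn (d n)) w)).
Let r n : R := 2^-1 ^+ n.
Let eta n w := g n w + r n.
Let zeta n w := h n w + r n.
Let rho n w := lambda n * mu1 n w + (1 + mu1 n w) * (lambda n * mu2 n w)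
  + (1 + mu1 n w) * (1 + mu2 n w) * zeta n w.
Let kappa n w := (1 + mu1 n w) * (1 + zeta n w) * (lambda n * nu2 n w)
  + (1 + mu1 n w) * (h n w ^+ 2 + h n w) + lambda n * nu1 n w.
Let chi n w := eta n w + rho n w + eta n w * rho n w.
Let eps n w := (1 + eta n w) * kappa n w + g n w ^+ 2 + g n w.
Let theta n w := lambda n * (1 - lambda n) * tau n w + lambda n * theta1 n w
  + lambda n * theta2 n w.

Let l_ge0 n : 0 <= lambda n. Proof. by case/andP: (lambda_itv n) => /ltW. Qed.

Let l_le1 n : 0 <= 1 - lambda n.
Proof. by rewrite subr_ge0; case/andP: (lambda_itv n). Qed.

Let r_gt0 n : 0 < r n. Proof. by rewrite exprn_gt0 // invr_gt0. Qed.

Let msq (u : T -> H) : random_vector u -> measurable_fun [set: T] (sqn u).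
Proof. exact: random_vector_sqr_norm. Qed.

Let sq_ge0 (u : T -> H) w : 0 <= `|u w| ^+ 2. Proof. exact: exprn_ge0. Qed.

Let mx n : random_vector (x n). Proof. by case: (x_L2 n). Qed.

Let mt n : random_vector (t n). Proof. by case: (t_L2 n). Qed.

Let mc n : random_vector (c n). Proof. by case: (c_L2 n). Qed.

Let md n : random_vector (d n). Proof. by case: (d_L2 n). Qed.

Let mBz (u : T -> H) : random_vector u ->
  measurable_fun [set: T] (fun w => `|u w - z| ^+ 2).
Proof. by move=> mu; apply: measurable_funX; exact: random_vector_norm. Qed.

Let mtx n : measurable_fun [set: T] (fun w => `|t n w - x n w| ^+ 2).
Proof. by apply: msq; exact: (random_vectorB ip_norm H_separable). Qed.

Let msd n : measurable_fun [set: T] (fun w => `|s n w + d n w| ^+ 2).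
Proof. by apply: msq; exact: (random_vectorD ip_norm H_separable). Qed.

Let fine_ce_ge0 n (f : T -> R) : measurable_fun [set: T] f ->
  (forall w, 0 <= f w) -> forall w, 0 <= fine (ce n f w).
Proof. by move=> mf f0 w; rewrite fine_ge0 // cond_exp_ge0. Qed.

Let alpha_adapted : adapted X alpha.
Proof.
move=> n; apply: measurable_funX.
apply: (@random_vector_norm R H _ (g_sigma_algebraType (X n)) (x n) z).
move=> _ Y mY; rewrite setTI; apply: sub_sigma_algebra; apply: X_x.
(* [x n] is the last of the maps generating [sigma(x_0, ..., x_n)]. *)
apply: sub_sigma_algebra; rewrite big_ord_recr; right.
by exists Y => //; rewrite setTI.
Qed.

Let ce_adapted (f : nat -> T -> R) : (forall n, measurable_fun [set:
  T] (f n)) ->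
  (forall n w, 0 <= f n w) -> adapted X (fun n w => fine (ce n (f n) w)).
Proof. by move=> mf f0 n; exact: cond_exp_measurable. Qed.

Let adaptedD (u v : nat -> T -> R) : adapted X u -> adapted X v ->
  adapted X (fun n w => u n w + v n w).
Proof. by move=> mu mv n; apply: measurable_funD; [exact: mu | exact: mv]. Qed.

Let adaptedM (u v : nat -> T -> R) : adapted X u -> adapted X v ->
  adapted X (fun n w => u n w * v n w).
Proof. by move=> mu mv n; apply: measurable_funM; [exact: mu | exact: mv]. Qed.

Let adapted_cst (u : nat -> R) : adapted X (fun n _ => u n).
Proof. by move=> n; exact: measurable_cst. Qed.

Let adapted_sqrt (u : nat -> T -> R) : adapted X u ->
  adapted X (fun n w => Num.sqrt (u n w)).
Proof.
move=> mu n; apply: measurableT_comp; last exact: mu.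
by apply: continuous_measurable_fun; exact: sqrt_continuous.
Qed.

Let ell_adapted (u : nat -> T -> R) : ell_plus X u -> adapted X u.
Proof. by move=> uX n; case: (uX n). Qed.

Let g_adapted : adapted X g.
Proof.
apply: adaptedM; first exact: adapted_cst.
by apply: adapted_sqrt; apply: ce_adapted => n //; exact: msq.
Qed.

Let h_adapted : adapted X h.
Proof.
apply: adapted_sqrt; apply: adaptedM; first exact: adapted_cst.
by apply: ce_adapted => n //; exact: msq.
Qed.

Let tau_adapted : adapted X tau.
Proof. by apply: ce_adapted => n // w; rewrite exprn_ge0. Qed.

Let param_adapted :
  [/\ adapted X mu1, adapted X mu2, adapted X nu1, adapted X nu2 &
     adapted X theta1 /\ adapted X theta2].
Proof.
by split; [| | | |split]; apply: ell_adapted;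
  [case: mu1_ell | case: mu2_ell | case: nu1_ell | case: nu2_ell | |].
Qed.

Let eta_adapted : adapted X eta.
Proof. by apply: adaptedD => //; exact: adapted_cst. Qed.

Let zeta_adapted : adapted X zeta.
Proof. by apply: adaptedD => //; exact: adapted_cst. Qed.

Let rho_adapted : adapted X rho.
Proof.
have [? ? ? ? [? ?]] := param_adapted.
by do ?[assumption | exact: adapted_cst | apply: adaptedD | apply: adaptedM].
Qed.

Let kappa_adapted : adapted X kappa.
Proof.
have [? ? ? ? [? ?]] := param_adapted.
by do ?[assumption | exact: adapted_cst | apply: adaptedD | apply: adaptedM].
Qed.

Let chi_adapted : adapted X chi.
Proof. by do ?[assumption | exact: adapted_cst | apply: adaptedD | apply:
  adaptedM]. Qed.

Let eps_adapted : adapted X eps.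
Proof.
by do ?[assumption | exact: adapted_cst | apply: adaptedD | apply: adaptedM].
Qed.

Let theta_adapted : adapted X theta.
Proof.
have [? ? ? ? [? ?]] := param_adapted.
by do ?[assumption | exact: adapted_cst | apply: adaptedD | apply: adaptedM].
Qed.

Let param_ge0 n w : [/\ 0 <= mu1 n w, 0 <= mu2 n w, 0 <= nu1 n w, 0 <= nu2 n w &
  0 <= theta1 n w /\ 0 <= theta2 n w].
Proof.
have [m1 _] := mu1_ell; have [m2 _] := mu2_ell.
have [n1 _] := nu1_ell; have [n2 _] := nu2_ell.
by split; [case: (m1 n)|case: (m2 n)|case: (n1 n)|case: (n2 n)|split;
  [case: (theta1_ell n)|case: (theta2_ell n)]].
Qed.

Let g_ge0 n w : 0 <= g n w. Proof. by rewrite mulr_ge0. Qed.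

Let h_ge0 n w : 0 <= h n w. Proof. exact: sqrtr_ge0. Qed.

Let eta_ge0 n w : 0 <= eta n w. Proof. by rewrite addr_ge0 // ltW. Qed.

Let zeta_ge0 n w : 0 <= zeta n w. Proof. by rewrite addr_ge0 // ltW. Qed.

Let tau_ge0 n w : 0 <= tau n w.
Proof. by apply: fine_ce_ge0 => // v; rewrite exprn_ge0. Qed.

Let rho_ge0 n w : 0 <= rho n w.
Proof.
have [? ? ? ? _] := param_ge0 n w.
by rewrite !addr_ge0 // ?mulr_ge0 // ?addr_ge0 // ?mulr_ge0 // addr_ge0.
Qed.

Let kappa_ge0 n w : 0 <= kappa n w.
Proof.
have [? ? ? ? _] := param_ge0 n w; have ? := zeta_ge0 n w.
rewrite /kappa addr_ge0 ?(mulr_ge0 (l_ge0 n)) // addr_ge0 //.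
  by rewrite !mulr_ge0 // addr_ge0.
by rewrite mulr_ge0 ?addr_ge0 // sqr_ge0.
Qed.

Let chi_ge0 n w : 0 <= chi n w.
Proof. by rewrite /chi; apply: addr_ge0;
  [exact: addr_ge0 | exact: mulr_ge0]. Qed.

Let eps_ge0 n w : 0 <= eps n w.
Proof.
rewrite /eps; apply: addr_ge0 => //; apply: addr_ge0; last exact: sqr_ge0.
by apply: mulr_ge0 => //; exact: addr_ge0.
Qed.

Let theta_ge0 n w : 0 <= theta n w.
Proof.
have [_ _ _ _ [? ?]] := param_ge0 n w.
rewrite /theta; apply: addr_ge0; last exact: mulr_ge0.
by apply: addr_ge0; apply: mulr_ge0 => //; exact: mulr_ge0.
Qed.

(** Pathwise bookkeeping: each summand of [chi] and [eps] is a bounded factor times a summable one,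
    and the summable [eta] and [zeta] also serve as bounded factors. *)
Let chi_sum_of w : bounded_sums (g ^~ w) -> bounded_sums (h ^~ w) ->
  bounded_sums (fun n => lambda n * mu1 n w) ->
  bounded_sums (fun n => lambda n * mu2 n w) ->
  bounded_sums (fun n => lambda n * nu1 n w) ->
  bounded_sums (fun n => lambda n * nu2 n w) ->
  (exists2 B, 0 <= B & forall n, mu1 n w <= B) ->
  (exists2 B, 0 <= B & forall n, mu2 n w <= B) ->
  bounded_sums (chi ^~ w) /\ bounded_sums (eps ^~ w).
Proof.
move=> sg sh sm1 sm2 sn1 sn2 [B1 B10 muB1] [B2 B20 muB2].
have seta : bounded_sums (eta ^~ w).
  exact: (bounded_sumsD sg (bounded_sums_geometric R)).
have szeta : bounded_sums (zeta ^~ w).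
  exact: (bounded_sumsD sh (bounded_sums_geometric R)).
have [Bz Bz0 zetaB] := bounded_sums_le (zeta_ge0 ^~ w) szeta.
have [Be Be0 etaB] := bounded_sums_le (eta_ge0 ^~ w) seta.
have p0 n := param_ge0 n w.
have srho : bounded_sums (rho ^~ w).
  apply: bounded_sumsD; first apply: bounded_sumsD => //.
    apply: (bounded_sumsM (B := 1 + B1)) => // [|n|n]; first exact: addr_ge0.
      by rewrite lerD2l.
    by case: (p0 n) => *; exact: mulr_ge0.
  apply: (bounded_sumsM (B := (1 + B1) * (1 + B2))) => // [|n].
    by rewrite mulr_ge0 // addr_ge0.
  by case: (p0 n) => *; rewrite ler_pM ?addr_ge0 // lerD2l.
have skappa : bounded_sums (kappa ^~ w).
  apply: bounded_sumsD => //; apply: bounded_sumsD.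
    apply: (bounded_sumsM (B := (1 + B1) * (1 + Bz))) => // [|n|n].
    - by rewrite mulr_ge0 // addr_ge0.
    - by case: (p0 n) => *; apply: ler_pM; rewrite ?lerD2l //; exact: addr_ge0.
    - by case: (p0 n) => *; exact: mulr_ge0.
  apply: (bounded_sumsM (B := 1 + B1)) => [|n|n|].
  - exact: addr_ge0.
  - by rewrite lerD2l.
  - by rewrite addr_ge0 // sqr_ge0.
  - by apply: bounded_sumsD => //; exact: bounded_sums_sqr.
split.
  apply: bounded_sumsD; first exact: bounded_sumsD.
  exact: (bounded_sumsM Be0 etaB).
apply: bounded_sumsD => //; apply: bounded_sumsD; last exact: bounded_sums_sqr.
apply: (bounded_sumsM (B := 1 + Be)) => // [|n]; first exact: addr_ge0.
by rewrite lerD2l.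
Qed.

(** * Almost sure summability of the error terms *)

Let ell_oo_bounded (u : nat -> T -> R) : ell_plus_oo P X u ->
  {ae P, forall w, exists2 B, 0 <= B & forall n, u n w <= B}.
Proof.
move=> [uX]; apply: filterS => w sup_lty.
have ge_u n : ((u n w)%:E <= ereal_sup (range (fun n => (u n w)%:E)))%E.
  by apply: ereal_sup_ubound; exists n.
have sup_ge0 : (0 <= ereal_sup (range (fun n => (u n w)%:E)))%E.
  by apply: le_trans (ge_u 0%N); rewrite lee_fin; case: (uX 0%N).
exists (fine (ereal_sup (range (fun n => (u n w)%:E)))); first exact: fine_ge0.
by move=> n; rewrite -lee_fin fineK ?ge0_fin_numE.
Qed.

Let ell1_bounded_sums (u : nat -> T -> R) : ell_plus_p P 1 X u ->
  {ae P, forall w, bounded_sums (u ^~ w)}.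
Proof.
move=> [uX]; apply: filterS => w sum_lty.
have u0 n : 0 <= u n w by case: (uX n).
apply/bounded_sums_nneseries => //.
by move: sum_lty; under eq_eseriesr do rewrite (powRr1 (u0 _)).
Qed.

(** The square roots are summable, hence bounded, so their squares are summable too. *)
Let ell12_bounded_sums (u : nat -> T -> R) : ell_plus_p P (1 / 2) X u ->
  {ae P, forall w, bounded_sums (u ^~ w)}.
Proof.
move=> [uX]; apply: filterS => w sum_lty.
have u0 n : 0 <= u n w by case: (uX n).
have : bounded_sums (fun n => Num.sqrt (u n w)).
  apply/bounded_sums_nneseries => [n|]; first exact: sqrtr_ge0.
  by move: sum_lty; rewrite mul1r; under eq_eseriesr do rewrite (powR12_sqrt
    (u0 _)).
move=> /(bounded_sums_sqr (fun n => sqrtr_ge0 _)).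
by apply: bounded_sumsS => n; rewrite sqr_sqrtr.
Qed.

Let ce_fin (f : nat -> T -> R) : (forall n, measurable_fun [set: T] (f n)) ->
  (forall n w, 0 <= f n w) -> (forall n, \int[P]_w (f n w)%:E < +oo)%E ->
  {ae P, forall w, forall n, ce n (f n) w \is a fin_num}.
Proof. by move=> mf f0 intf; apply: ae_foralln => n; exact: cond_exp_lty. Qed.

Let c_fin : {ae P, forall w, forall n, ce n (sqn (c n)) w \is a fin_num}.
Proof.
by apply: ce_fin => n; [exact: msq | move=> w; exact: sq_ge0 | case: (c_L2 n)].
Qed.

Let d_fin : {ae P, forall w, forall n, ce n (sqn (d n)) w \is a fin_num}.
Proof.
by apply: ce_fin => n; [exact: msq | move=> w; exact: sq_ge0 | case: (d_L2 n)].
Qed.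

Let tx_fin : {ae P, forall w, forall n,
  ce n (fun v => `|t n v - x n v| ^+ 2) w \is a fin_num}.
Proof.
apply: ce_fin => n; [exact: mtx | by move=> w; exact: exprn_ge0 |].
exact: integral_sqr_normB_lty.
Qed.

Let g_sum : {ae P, forall w, bounded_sums (g ^~ w)}.
Proof.
apply: filterS2 c_fin c_sum => w cfin sum_lty.
apply/bounded_sums_nneseries => //.
rewrite (eq_eseriesr (g := fun n => (lambda n)%:E * sqrte (ce n (sqn (c n))
  w))%E) // => n _.
by rewrite -[X in sqrte X]fineK.
Qed.

Let h_sum : {ae P, forall w, bounded_sums (h ^~ w)}.
Proof.
apply: filterS2 d_fin d_sum => w dfin sum_lty.
apply/bounded_sums_nneseries => //.
rewrite (eq_eseriesr (g := fun n => sqrte ((lambda n)%:E * ce n (sqn (d n))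
  w))%E) // => n _.
by rewrite -[X in (_ * X)%E]fineK.
Qed.

Let chi_eps_sum :
  {ae P, forall w, bounded_sums (chi ^~ w) /\ bounded_sums (eps ^~ w)}.
Proof.
have Fi : Filter (almost_everywhere P) by exact: _.
near=> w; apply: chi_sum_of; near: w.
- exact: g_sum.
- exact: h_sum.
- exact: ell1_bounded_sums.
- exact: ell1_bounded_sums.
- exact: ell12_bounded_sums.
- exact: ell12_bounded_sums.
- exact: ell_oo_bounded.
- exact: ell_oo_bounded.
Unshelve. all: by end_near. Qed.

(** The convexity identity for the relaxed point [x n + lambda n (t n - x n)]. The subtracted term
    becomes the quantity of (ii) once moved to the left in [convex_le]. *)
Let yy n w := (1 - lambda n) * alpha n w + lambda n * `|t n w - z| ^+ 2
  - lambda n * (1 - lambda n) * `|t n w - x n w| ^+ 2.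

Let yyE n w : yy n w = `|x n w + lambda n *: (t n w - x n w) - z| ^+ 2.
Proof.
rewrite /yy /alpha.
have -> : x n w + lambda n *: (t n w - x n w) - z =
    (x n w - z) + lambda n *: (t n w - x n w) by rewrite addrAC.
have -> : t n w - z = (x n w - z) + (t n w - x n w).
  by rewrite [RHS]addrC addrA subrK.
move: (x n w - z) (t n w - x n w) => u v.
rewrite !(sqr_normD ip_norm) normrZ ipZr exprMn real_normK ?num_real //.
by ring.
Qed.

Let yy_ge0 n w : 0 <= yy n w. Proof. by rewrite yyE exprn_ge0. Qed.

Let myy n : measurable_fun [set: T] (yy n).
Proof.
apply: measurable_funB; last exact: measurable_funM.
by apply: measurable_funD; apply: measurable_funM => //; exact: mBz.
Qed.

Let young_c n : {ae P, forall w, ce n (yy n) w \is a fin_num ->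
  ce n (sqn (c n)) w \is a fin_num ->
  ce n (alpha n.+1) w \is a fin_num /\ forall e : R, 0 < e ->
  fine (ce n (alpha n.+1) w) <= (1 + e) * fine (ce n (yy n) w)
    + (1 + e^-1) * (lambda n ^+ 2 * fine (ce n (sqn (c n)) w))}.
Proof.
apply: cond_exp_young => //; try exact: mBz; try exact: msq.
- exact: sqr_ge0.
- by move=> w; exact: exprn_ge0.
apply: filterS (x_rec n) => w xw e e0; rewrite yyE /alpha xw.
have -> : x n w + lambda n *: (t n w + c n w - x n w) - z =
    (x n w + lambda n *: (t n w - x n w) - z) + lambda n *: c n w.
  by rewrite addrAC (addrAC (t n w)) scalerDr addrA (addrAC (x n w) (- z)).
apply: le_trans (sqr_normD_young _ _ e0) _.
by rewrite normrZ exprMn real_normK ?num_real.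
Qed.

Let convex_le n : {ae P, forall w, (ce n (yy n) w
  + (lambda n * (1 - lambda n))%:E * ce n (fun v => `|t n v - x n v| ^+ 2) w
  <= (1 - lambda n)%:E * ce n (alpha n) w
     + (lambda n)%:E * ce n (fun v => `|t n v - z| ^+ 2) w)%E}.
Proof.
apply: cond_exp_le_linear => //; try exact: mBz.
- by move=> w; exact: exprn_ge0.
- exact: mulr_ge0.
by apply: aeW => w; rewrite /yy subrK.
Qed.

Let young_d n : {ae P, forall w, ce n (sqn (s n)) w \is a fin_num ->
  ce n (sqn (d n)) w \is a fin_num ->
  ce n (fun v => `|s n v + d n v| ^+ 2) w \is a fin_num /\
  forall e : R, 0 < e ->
  fine (ce n (fun v => `|s n v + d n v| ^+ 2) w) <=
    (1 + e) * fine (ce n (sqn (s n)) w)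
    + (1 + e^-1) * (1 * fine (ce n (sqn (d n)) w))}.
Proof.
apply: cond_exp_young => //; try exact: msq.
by apply: aeW => w e e0; rewrite mul1r; exact: sqr_normD_young.
Qed.

Let step n : {ae P, forall w, (ce n (alpha n.+1) w + (theta n w)%:E
  <= ((1 + chi n w) * alpha n w + eps n w)%:E)%E}.
Proof.
have self := cond_exp_le_self P (X_sub n) (@alpha_adapted n) (fun w =>
  exprn_ge0 2 (normr_ge0 _)).
have ce0 (f : T -> R) : measurable_fun [set: T] f -> (forall w, 0 <= f w) ->
    forall w, (0 <= ce n f w)%E by exact: cond_exp_ge0.
apply: filterS2 (filterI c_fin (filterI d_fin tx_fin))
  (filterI (young_c n) (filterI (convex_le n) (filterI (young_d n)
  (filterI (t_ineq n) (filterI (s_ineq n) self))))) => w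
  [/(_ n) cfin [/(_ n) dfin /(_ n) txfin]] [yc [cvx [yd [t_le [s_le a_le]]]]].
have [mu1_0 mu2_0 nu1_0 nu2_0 [th1_0 th2_0]] := param_ge0 n w.
(* Finiteness is propagated along [s], [s + d], [t], [yy] and [alpha n.+1], each from the inequality
   that bounds it; only then is the estimate read in the reals. *)
have sfin : ce n (sqn (s n)) w \is a fin_num.
  by apply: (fin_num_leD (ce0 _ (msq (s_rv n)) _ w) th2_0 s_le) => v;
    exact: exprn_ge0.
have [sdfin sd_le] := yd sfin dfin.
have tfin : ce n (fun v => `|t n v - z| ^+ 2) w \is a fin_num.
  move: t_le; rewrite -[X in (_ <= _ * X + _)%E](fineK sdfin) -EFinM -EFinD =>
    t_le.
  by apply: (fin_num_leD (ce0 _ (mBz (mt n)) _ w) th1_0 t_le) => v;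
    exact: exprn_ge0.
have afin : ce n (alpha n) w \is a fin_num.
  rewrite ge0_fin_numE; first exact: le_lt_trans a_le (ltry _).
  by apply: ce0 => [|v]; [exact: mBz | exact: exprn_ge0].
have yfin : ce n (yy n) w \is a fin_num.
  move: cvx; rewrite -(fineK txfin) -(fineK tfin) -(fineK afin) -!EFinM -EFinD
    => y_le.
  apply: (fin_num_leD (ce0 _ (myy n) (yy_ge0 n) w) _ y_le).
  by rewrite mulr_ge0 ?mulr_ge0 ?tau_ge0.
have [a'fin a'_le] := yc yfin cfin.
rewrite -(fineK a'fin) -EFinD lee_fin.
have l2 := mulr_ge0 (l_ge0 n) (fine_ce_ge0 n (msq (md n)) (fun v =>
  exprn_ge0 2 (normr_ge0 _)) w).
apply: (@descent_step _ (lambda n) (alpha n w) _ (fine (ce n (yy n) w)) (tau n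
  w)
   (fine (ce n (fun v => `|t n v - z| ^+ 2) w))
   (fine (ce n (fun v => `|s n v + d n v| ^+ 2) w)) (fine (ce n (sqn (s n))
     w)) (g n w) (h n w)
   (fine (ce n (sqn (c n)) w)) (fine (ce n (sqn (d n)) w))) => //.
- exact: exprn_ge0.
- by apply: fine_ce_ge0 => [|v]; [exact: msq | exact: exprn_ge0].
- rewrite /g exprMn sqr_sqrtr //.
  by apply: fine_ce_ge0 => [|v]; [exact: msq | exact: exprn_ge0].
- by rewrite /h sqr_sqrtr.
- by apply: a'_le; exact: ltr_wpDl.
- have := cvx; rewrite -[X in (X + _ <= _)%E](fineK yfin) -(fineK txfin)
    -(fineK tfin) -(fineK afin) -!EFinM -!EFinD lee_fin => /le_trans; apply.
  rewrite lerD2r; apply: ler_wpM2l => //.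
  by move: a_le; rewrite -{1}(fineK afin) lee_fin.
- by move: t_le; rewrite -[X in (X + _ <= _)%E](fineK tfin)
    -[X in (_ <= _ * X + _)%E](fineK sdfin) -EFinM -!EFinD lee_fin.
- by have := sd_le (zeta n w) (ltr_wpDl (h_ge0 n w) (r_gt0 n)); rewrite mul1r.
- by move: s_le; rewrite -[X in (X + _ <= _)%E](fineK sfin) -EFinD lee_fin.
Qed.

(** The Robbins-Siegmund theorem is applied to the squared distance and a square root is taken. The
    last conjunct allows (ii) to return from [fine] to extended reals. *)
Lemma stochastic_fejer : {ae P, forall w,
  [/\ cvg (`|x n w - z| @[n --> \oo]),
      bounded_sums (fun n => lambda n * theta1 n w),
      bounded_sums (fun n => lambda n * theta2 n w) &
      bounded_sums (fun n => lambda n * (1 - lambda n) *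
        fine (ce n (fun v => `|t n v - x n v| ^+ 2) w)) /\
      forall n, ce n (fun v => `|t n v - x n v| ^+ 2) w \is a fin_num]}.
Proof.
have alpha0_int : (\int[P]_w (alpha 0%N w)%:E < +oo)%E.
  apply: (integral_sqr_normB_lty ip_norm H_separable (x_L2 0%N) (v := cst z)).
  split; first exact: measurable_cst.
  have -> : (fun w => (`|cst z w| ^+ 2)%:E) = cst (`|z| ^+ 2)%:E :> (T -> \bar
    R) by [].
  by rewrite integral_cst // [X in (_ * X)%E]probability_setT mule1 ltry.
have chi_sum : {ae P, forall w, bounded_sums (chi ^~ w)}.
  by apply: filterS chi_eps_sum => w [].
have eps_sum : {ae P, forall w, bounded_sums (eps ^~ w)}.
  by apply: filterS chi_eps_sum => w [].
have main := almost_supermartingale X_sub X_incr alpha_adapted chi_adapted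
  eps_adapted theta_adapted (fun n w => exprn_ge0 2 (normr_ge0 _)) chi_ge0
    eps_ge0
  theta_ge0 alpha0_int _ chi_sum eps_sum.
apply: filterS2 (main _) tx_fin => [w [a_cvg th_sum] txfin|n]; last first.
  exists (ce n (alpha n.+1)); last exact: step.
  apply: cond_expP => //; first exact: mBz.
  by move=> w; exact: exprn_ge0.
have p0 n := param_ge0 n w.
split.
- rewrite (_ : (fun n => _) = (fun n => Num.sqrt (alpha n w))).
    apply/cvg_ex; exists (Num.sqrt (lim (alpha ^~ w @ \oo))).
    by apply: continuous_cvg; [exact: sqrt_continuous | exact: a_cvg].
  by apply/funext => n; rewrite /alpha sqrtr_sqr normr_id.
- apply: bounded_sumsS th_sum => n; case: (p0 n) => _ _ _ _ [? ?].
  rewrite /theta addrAC lerDr addr_ge0 ?mulr_ge0 //; exact: tau_ge0.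
- apply: bounded_sumsS th_sum => n; case: (p0 n) => _ _ _ _ [? ?].
  rewrite /theta lerDr addr_ge0 ?mulr_ge0 //; exact: tau_ge0.
- split => //; apply: bounded_sumsS th_sum => n; case: (p0 n) => _ _ _ _ [? ?].
  by rewrite /theta -addrA lerDl addr_ge0 ?mulr_ge0.
Qed.

End stochastic_fejer.

Theorem theorem3p2
  (R : realType) (H : completeNormedModType R) (ip : {dot H for idfun})
  (ip_norm : induces_norm ip) (H_separable : separable H)
  (disp : measure_display) (T : measurableType disp) (P : probability T R)
  (F : set H) (F_nonempty : F !=set0) (F_closed : closed F)
  (lambda : nat -> R) (lambda_itv : forall n, 0 < lambda n <= 1)
  (x t c d : nat -> T -> H)
  (x_L2 : forall n, in_L2 P (x n)) (t_L2 : forall n, in_L2 P (t n))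
  (c_L2 : forall n, in_L2 P (c n)) (d_L2 : forall n, in_L2 P (d n))
  (* (a) *)
  (X : nat -> set (set T))
  (X_sub : forall n, is_sub_sigma_algebra (X n))
  (X_x : forall n,
    g_sigma_preimage (fun i : 'I_n.+1 => (x i : T -> borelType H)) `<=` X n)
  (X_incr : forall n, X n `<=` X n.+1)
  (* (b) *)
  (x_rec : forall n, {ae P, forall w,
    x n.+1 w = x n w + lambda n *: (t n w + c n w - x n w)})
  (* (c) *)
  (c_sum : {ae P, forall w, (\sum_(0 <= n <oo)
    (lambda n)%:E * sqrte (cond_exp P (X n) (fun v => (`|c n v| ^+ 2)%:E) w)
      < +oo)%E})
  (d_sum : {ae P, forall w, (\sum_(0 <= n <oo)
    sqrte ((lambda n)%:E * cond_exp P (X n) (fun v => (`|d n v| ^+ 2)%:E) w)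
      < +oo)%E})
  (* (d) *)
  (s : H -> nat -> T -> H) (theta1 theta2 mu1 mu2 nu1 nu2 : H -> nat -> T -> R)
  (s_rv : forall z, F z -> forall n, random_vector (s z n))
  (theta1_ell : forall z, F z -> ell_plus X (theta1 z))
  (theta2_ell : forall z, F z -> ell_plus X (theta2 z))
  (mu1_ell : forall z, F z -> ell_plus_oo P X (mu1 z))
  (mu2_ell : forall z, F z -> ell_plus_oo P X (mu2 z))
  (nu1_ell : forall z, F z -> ell_plus_oo P X (nu1 z))
  (nu2_ell : forall z, F z -> ell_plus_oo P X (nu2 z))
  (lmu1_ell : forall z, F z ->
    ell_plus_p P 1 X (fun n w => lambda n * mu1 z n w))
  (lmu2_ell : forall z, F z ->
    ell_plus_p P 1 X (fun n w => lambda n * mu2 z n w))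
  (lnu1_ell : forall z, F z ->
    ell_plus_p P (1 / 2) X (fun n w => lambda n * nu1 z n w))
  (lnu2_ell : forall z, F z ->
    ell_plus_p P (1 / 2) X (fun n w => lambda n * nu2 z n w))
  (t_ineq : forall z, F z -> forall n, {ae P, forall w,
    (cond_exp P (X n) (fun v => (`|t n v - z| ^+ 2)%:E) w + (theta1 z n w)%:E
     <= (1 + mu1 z n w)%:E
          * cond_exp P (X n) (fun v => (`|s z n v + d n v| ^+ 2)%:E) w
        + (nu1 z n w)%:E)%E})
  (s_ineq : forall z, F z -> forall n, {ae P, forall w,
    (cond_exp P (X n) (fun v => (`|s z n v| ^+ 2)%:E) w + (theta2 z n w)%:E
     <= ((1 + mu2 z n w) * `|x n w - z| ^+ 2 + nu2 z n w)%:E)%E}) :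
  (* (i) *)
  (forall z, F z ->
    {ae P, forall w,
      (\sum_(0 <= n <oo) (lambda n * theta1 z n w)%:E < +oo)%E} /\
    {ae P, forall w,
      (\sum_(0 <= n <oo) (lambda n * theta2 z n w)%:E < +oo)%E}) /\
  (* (ii) *)
  {ae P, forall w, (\sum_(0 <= n <oo)
    (lambda n * (1 - lambda n))%:E
      * cond_exp P (X n) (fun v => (`|t n v - x n v| ^+ 2)%:E) w < +oo)%E} /\
  (* (iii) *)
  ({ae P, forall w, weak_cluster ip (x ^~ w) `<=` F} ->
    as_weakly_cvg_in P ip F x) /\
  (* (iv) *)
  ({ae P, forall w, strong_cluster (x ^~ w) `&` F !=set0} ->
    as_strongly_cvg_in P F x) /\
  (* (v) *)
  ({ae P, forall w, strong_cluster (x ^~ w) !=set0} ->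
    {ae P, forall w, weak_cluster ip (x ^~ w) `<=` F} ->
    as_strongly_cvg_in P F x).
Proof.
have fejer z (Fz : F z) := stochastic_fejer ip_norm H_separable lambda_itv
  x_L2 t_L2
  c_L2 d_L2 X_sub X_x X_incr x_rec c_sum d_sum (s_rv z Fz) (theta1_ell z Fz)
  (theta2_ell z Fz) (mu1_ell z Fz) (mu2_ell z Fz) (nu1_ell z Fz) (nu2_ell z Fz)
  (lmu1_ell z Fz) (lmu2_ell z Fz) (lnu1_ell z Fz) (lnu2_ell z Fz) (t_ineq z Fz)
  (s_ineq z Fz).
have l_ge0 n : 0 <= lambda n by case/andP: (lambda_itv n) => /ltW.
have l_le1 n : 0 <= 1 - lambda n by rewrite subr_ge0; case/andP: (lambda_itv n).
have x_rv n : random_vector (x n) by case: (x_L2 n).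
have x_cvg : {ae P, forall w, forall z, F z -> cvg (`|x n w - z| @[n --> \oo])}.
  have [e Fe e_dense] := dense_seq_in H_separable F_nonempty.
  have : {ae P, forall w, forall i, cvg (`|x n w - e i| @[n --> \oo])}.
    by apply: ae_foralln => i; apply: filterS (fejer _ (Fe i)) => w [].
  by apply: filterS => w xe; exact: (cvg_dist_dense e_dense).
have strong : {ae P, forall w, strong_cluster (x ^~ w) `&` F !=set0} ->
    as_strongly_cvg_in P F x.
  move=> cluster.
  apply: (random_vector_strong_lim ip_norm H_separable F_nonempty x_rv).
  apply: filterS2 cluster x_cvg => w [y [xy Fy]] xF; exists y => //.
  exact: strong_cluster_cvg (xF _ Fy) xy.
split.
  move=> z Fz; split; apply: filterS (fejer z Fz) => w [_ sum1 sum2 _];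
    apply/bounded_sums_nneseries => // n; apply: mulr_ge0 => //.
    by case: (theta1_ell z Fz n).
  by case: (theta2_ell z Fz n).
split.
  (* The series of (ii) does not involve [z], so any point of [F] will do. *)
  have [z Fz] := F_nonempty.
  apply: filterS (fejer z Fz) => w [_ _ _ [sum_tau tau_fin]].
  under eq_eseriesr do rewrite -[X in (_ * X)%E](fineK (tau_fin _)).
  apply/bounded_sums_nneseries => // n.
  apply: mulr_ge0; first exact: mulr_ge0.
  rewrite fine_ge0 //; apply: cond_exp_ge0 => //.
  apply: random_vector_sqr_norm; apply:
    (random_vectorB ip_norm H_separable) => //.
  by case: (t_L2 n).
split.
  move=> weak.
  apply: (random_vector_weak_lim ip_norm H_separable F_nonempty x_rv).
  apply: filterS2 weak x_cvg => w xWF xF.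
  exact: opial_weak.
(* A strong cluster point is a weak one, hence lies in [F]: (v) reduces to (iv). *)
split=> // nonempty weak; apply: strong.
apply: filterS2 nonempty weak => w [y xy] xWF; exists y; split => //.
by apply: xWF; exact: (strong_cluster_weak ip_norm).
Qed.
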